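(* Let $m\ge1$ and $n\ge0$ be integers, let $\mu\in\mathbb{C}$, and let $\widehat{W}$ be the $\widehat{\mathfrak{gl}_{m|n}}(\mathbb{C})$-module (depending on $\mu$) defined in the context. If $\mu\neq0$, then $\widehat{W}$ is an infinite-dimensional irreducible $\widehat{\mathfrak{gl}_{m|n}}(\mathbb{C})$-module.
   Context: All vector spaces and algebras are over $\mathbb{C}$. $\mathfrak{gl}_{m|n}(\mathbb{C})$ is the general linear Lie superalgebra with matrix units $E_{i,j}$, $1\le i,j\le m+n$ (indices $1,\dots,m$ even, $m+1,\dots,m+n$ odd), with the invariant supersymmetric form $(a,b)=\mathrm{str}(ab)$. The affine Lie superalgebra is $\widehat{\mathfrak{gl}_{m|n}}(\mathbb{C})=\mathfrak{gl}_{m|n}(\mathbb{C})\otimes\mathbb{C}[t,t^{-1}]\oplus\mathbb{C}K\oplus\mathbb{C}d$ with $[a\otimes t^{m_1},b\otimes t^{n_1}]=[a,b]\otimes t^{m_1+n_1}+m_1\delta_{m_1,-n_1}(a,b)K$, $[d,a\otimes t^{m_1}]=m_1a\otimes t^{m_1}$, $K$ central, $K,d$ even. $\widehat{W}$ is the associative algebra generated by $x_i(r)$ ($2\le i\le m$, $r\in\mathbb{Z}$) and $y_k(r)$ ($1\le k\le n$, $r\in\mathbb{Z}$) subject to: the $x$'s commute with each other and with the $y$'s, and $y_k(r)y_l(s)=-y_l(s)y_k(r)$; $x_i(r)$ is even and $y_k(r)$ odd. $\frac{\partial}{\partial x_i(r)}$ (even) and $\frac{\partial}{\partial y_k(r)}$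 (odd) are the partial differential operators, with $[\frac{\partial}{\partial x_i(r)},x_j(s)]=\delta_{i,j}\delta_{r,s}$ and $\frac{\partial}{\partial y_k(r)}y_l(s)+y_l(s)\frac{\partial}{\partial y_k(r)}=\delta_{k,l}\delta_{r,s}$. The module structure: $E_{i,j}\otimes t^{m_1}$ acts as $e_{i,j}(m_1)$, $K$ acts as $0$, and $d$ acts as $D=\sum_{i=2}^m\sum_{r\in\mathbb{Z}}r\,x_i(r)\frac{\partial}{\partial x_i(r)}+\sum_{k=1}^n\sum_{r\in\mathbb{Z}}r\,y_k(r)\frac{\partial}{\partial y_k(r)}$, where for $m_1\in\mathbb{Z}$, $i,j=2,\dots,m$, $k,l=1,\dots,n$ (infinite sums are well defined since only finitely many terms act nontrivially on a given element): $e_{1,1}(m_1)=\mu\delta_{m_1,0}-\sum_{m_2\in\mathbb{Z}}\sum_{i=2}^m x_i(m_1+m_2)\frac{\partial}{\partial x_i(m_2)}-\sum_{m_2\in\mathbb{Z}}\sum_{k=1}^n y_k(m_1+m_2)\frac{\partial}{\partial y_k(m_2)}$, $e_{1,i}(m_1)=\sum_{m_2\in\mathbb{Z}}e_{1,1}(m_1+m_2)\frac{\partial}{\partial x_i(m_2)}$, $e_{1,m+k}(m_1)=\sum_{m_2\in\mathbb{Z}}e_{1,1}(m_1+m_2)\frac{\partial}{\partial y_k(m_2)}$, $e_{i,1}(m_1)=x_i(m_1)$, $e_{m+k,1}(m_1)=y_k(m_1)$, $e_{i,j}(m_1)=\sum_{m_2\in\mathbb{Z}}x_i(m_1+m_2)\frac{\partial}{\partial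 x_j(m_2)}$, $e_{i,m+k}(m_1)=\sum_{m_2\in\mathbb{Z}}x_i(m_1+m_2)\frac{\partial}{\partial y_k(m_2)}$, $e_{m+k,j}(m_1)=\sum_{m_2\in\mathbb{Z}}y_k(m_1+m_2)\frac{\partial}{\partial x_j(m_2)}$, $e_{m+k,m+l}(m_1)=\sum_{m_2\in\mathbb{Z}}y_k(m_1+m_2)\frac{\partial}{\partial y_l(m_2)}$.
   Formalization: Infinite-dimensionality is claimed only when m+n>1: for (m,n)=(1,0) there are no generators, so Ŵ=ℂ is one-dimensional and the claim fails; irreducibility is proved for all m≥1, n≥0. *)

(* Defs.v *)
From HB Require Import structures.
From mathcomp Require Import all_boot all_order all_algebra.
From mathcomp Require Import boolp classical_sets functions cardinality fsbigop.

Set Implicit Arguments.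
Unset Strict Implicit.
Unset Printing Implicit Defensive.

Import Order.TTheory GRing.Theory Num.Theory.
Local Open Scope ring_scope.
Local Open Scope quotient_scope.

(* Throughout, gl_{m|n} with m >= 1 is written with m = p.+1.  A sum
   \sum_(r \in [set: int]) F r is the sum of the finitely many nonzero terms. *)

Section SuperModules.
Variable K : numFieldType.

Definition is_grading (V : lmodType K) (V_ : bool -> {pred V}) : Prop :=
  (forall b, submod_closed (V_ b)) /\
  (forall v, exists! vv : V * V,
     [/\ vv.1 \in V_ false, vv.2 \in V_ true & v = vv.1 + vv.2]).

(* Everything is graded by Z/2, [false] being even and [true] odd. *)
Record is_super_module (L : lmodType K) (L_ : bool -> {pred L})
    (br : L -> L -> L) (V : lmodType K) (V_ : bool -> {pred V})
    (rho : L -> V -> V) : Prop := {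
  sm_grading : is_grading V_;
  sm_linearl : forall v, linear (rho ^~ v);
  sm_linearr : forall u, linear (rho u);
  sm_parity : forall b c u v,
    u \in L_ b -> v \in V_ c -> rho u v \in V_ (b (+) c);
  sm_bracket : forall b c u u' v, u \in L_ b -> u' \in L_ c ->
    rho (br u u') v =
      rho u (rho u' v) - (-1) ^+ (b && c) *: rho u' (rho u v)
}.

(* Submodules are not required to be Z/2-graded, so that irreducibility in this
   sense implies the absence of proper nonzero graded submodules. *)
Definition irreducible_super_module (L : lmodType K) (L_ : bool -> {pred L})
    (br : L -> L -> L) (V : lmodType K) (V_ : bool -> {pred V})
    (rho : L -> V -> V) : Prop :=
  [/\ is_super_module L_ br V_ rho,
      exists v : V, v != 0 &
      forall U : {pred V}, submod_closed U ->
        (forall u v, v \in U -> rho u v \in U) ->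
        (forall v, v \in U -> v = 0) \/ (forall v, v \in U)].

Definition infinite_dimensional (V : lmodType K) : Prop :=
  forall s : seq V, exists v : V,
    forall c : 'I_(size s) -> K, v <> \sum_(i < size s) c i *: s`_i.

End SuperModules.

Section Affine.
Variables (K : numFieldType) (p n : nat).

Local Notation gl := 'M[K]_(p.+1 + n).

Definition odd_index (i : 'I_(p.+1 + n)) : bool := (p.+1 <= i)%N.

Definition gl_part (b : bool) (A : gl) : gl :=
  \matrix_(i, j) (if odd_index i (+) odd_index j == b then A i j else 0).

Definition gl_bracket (A B : gl) : gl :=
  \sum_(b : bool) \sum_(c : bool)
    (gl_part b A *m gl_part c B
     - (-1) ^+ (b && c) *: (gl_part c B *m gl_part b A)).

Definition str (A : gl) : K := \sum_i (-1) ^+ odd_index i * A i i.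

Definition gl_form (A B : gl) : K := str (A *m B).

(* The loop algebra gl_{m|n} \otimes K[t, t^-1]; [f : loop] stands for
   \sum_r f r \otimes t^r. *)
Definition finitely_supported : {pred int -> gl} :=
  fun f => `[< finite_set [set r | f r != 0] >].

Record loop := Loop {
  loop_coef :> int -> gl;
  _ : loop_coef \in finitely_supported
}.
HB.instance Definition _ := [isSub for loop_coef].
HB.instance Definition _ := [Choice of loop by <:].

Lemma finitely_supported_submod : submod_closed finitely_supported.
Proof.
split=> [|a f g /asboolP hf /asboolP hg]; apply/asboolP.
  by rewrite (_ : mkset _ = set0) // -subset0 => r /=; rewrite eqxx.
apply: (sub_finite_set (B := ([set r | f r != 0] `|` [set r | g r != 0])%classic)).
  move=> r /=; have [f0|] := eqVneq (f r) 0; last by left.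
  have [g0|] := eqVneq (g r) 0; last by right.
  have -> : (a *: f + g) r = a *: f r + g r by [].
  by rewrite f0 g0 scaler0 addr0 eqxx.
by rewrite finite_setU.
Qed.
HB.instance Definition _ :=
  GRing.isSubmodClosed.Build K (int -> gl) finitely_supported
    finitely_supported_submod.
HB.instance Definition _ := [SubChoice_isSubLmodule of loop by <:].

Lemma tensor_subproof (a : gl) (r : int) :
  (fun s => if s == r then a else 0) \in finitely_supported.
Proof.
apply/asboolP; apply: (sub_finite_set (B := [set r]%classic)) => // s /=.
by case: (s =P r) => // _; rewrite eqxx.
Qed.
(* a \otimes t^r *)
Definition tensor (a : gl) (r : int) : loop := Loop (tensor_subproof a r).

(* (f, k, c) stands for f + k K + c d. *)
Definition ghat : Type := (loop * K^o * K^o)%type.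
HB.instance Definition _ := GRing.Lmodule.on ghat.

Definition loop_part (u : ghat) : loop := u.1.1.
Definition K_part (u : ghat) : K := u.1.2.
Definition d_part (u : ghat) : K := u.2.

Definition ghat_bracket (u v : ghat) : ghat :=
  (\sum_(r \in [set: int]) \sum_(s \in [set: int])
      tensor (gl_bracket (loop_part u r) (loop_part v s)) (r + s)
   + d_part u *: \sum_(s \in [set: int]) tensor (s%:~R *: loop_part v s) s
   - d_part v *: \sum_(r \in [set: int]) tensor (r%:~R *: loop_part u r) r,
   \sum_(r \in [set: int]) \sum_(s \in [set: int])
      (if r == - s then r%:~R * gl_form (loop_part u r) (loop_part v s) else 0),
   0).

Definition ghat_homog (b : bool) : {pred ghat} := fun u =>
  `[< (forall r, gl_part b (loop_part u r) = loop_part u r) /\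
      (b -> K_part u = 0 /\ d_part u = 0) >].

End Affine.

Section Presentation.
Variables (K : numFieldType) (p n : nat).

(* (inl i, r) is x_{i+2}(r) and (inr k, r) is y_{k+1}(r), because ordinals start
   at 0. *)
Definition gen : Type := (('I_p + 'I_n) * int)%type.

Inductive term : Type :=
| TGen of gen
| TZero
| TOne
| TAdd of term & term
| TScale of K & term
| TMul of term & term.

(* The smallest congruence on terms that makes them an associative unital
   K-algebra (opposites being scalings by -1) and contains the relations. *)
Inductive term_eq : term -> term -> Prop :=
| TE_refl t : term_eq t t
| TE_sym t u : term_eq t u -> term_eq u t
| TE_trans t u v : term_eq t u -> term_eq u v -> term_eq t v
| TE_add t t' u u' : term_eq t t' -> term_eq u u' ->
    term_eq (TAdd t u) (TAdd t' u')
| TE_scale a t t' : term_eq t t' -> term_eq (TScale a t) (TScale a t')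
| TE_mul t t' u u' : term_eq t t' -> term_eq u u' ->
    term_eq (TMul t u) (TMul t' u')
| TE_addA t u v : term_eq (TAdd t (TAdd u v)) (TAdd (TAdd t u) v)
| TE_addC t u : term_eq (TAdd t u) (TAdd u t)
| TE_add0 t : term_eq (TAdd TZero t) t
| TE_addN t : term_eq (TAdd (TScale (-1) t) t) TZero
| TE_scaleA a b t : term_eq (TScale a (TScale b t)) (TScale (a * b) t)
| TE_scale1 t : term_eq (TScale 1 t) t
| TE_scaleDr a t u :
    term_eq (TScale a (TAdd t u)) (TAdd (TScale a t) (TScale a u))
| TE_scaleDl a b t :
    term_eq (TScale (a + b) t) (TAdd (TScale a t) (TScale b t))
| TE_mulA t u v : term_eq (TMul t (TMul u v)) (TMul (TMul t u) v)
| TE_mul1l t : term_eq (TMul TOne t) t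
| TE_mul1r t : term_eq (TMul t TOne) t
| TE_mulDl t u v : term_eq (TMul (TAdd t u) v) (TAdd (TMul t v) (TMul u v))
| TE_mulDr t u v : term_eq (TMul t (TAdd u v)) (TAdd (TMul t u) (TMul t v))
| TE_scaleAl a t u : term_eq (TScale a (TMul t u)) (TMul (TScale a t) u)
| TE_scaleAr a t u : term_eq (TScale a (TMul t u)) (TMul t (TScale a u))
| TE_xx i r j s :
    term_eq (TMul (TGen (inl i, r)) (TGen (inl j, s)))
            (TMul (TGen (inl j, s)) (TGen (inl i, r)))
| TE_xy i r k s :
    term_eq (TMul (TGen (inl i, r)) (TGen (inr k, s)))
            (TMul (TGen (inr k, s)) (TGen (inl i, r)))
| TE_yy k r l s :
    term_eq (TMul (TGen (inr k, r)) (TGen (inr l, s)))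
            (TScale (-1) (TMul (TGen (inr l, s)) (TGen (inr k, r)))).

HB.instance Definition _ := gen_eqMixin term.
HB.instance Definition _ := gen_choiceMixin term.

Definition term_eqb : rel term := fun t u => `[< term_eq t u >].

Lemma term_eqb_refl : reflexive term_eqb.
Proof. by move=> t; apply/asboolP/TE_refl. Qed.
Lemma term_eqb_sym : symmetric term_eqb.
Proof. by move=> t u; apply/asboolP/asboolP; apply: TE_sym. Qed.
Lemma term_eqb_trans : transitive term_eqb.
Proof.
by move=> u t v /asboolP tu /asboolP uv; apply/asboolP/(TE_trans tu uv).
Qed.
Canonical term_equiv := EquivRel term_eqb term_eqb_refl term_eqb_sym
  term_eqb_trans.

Definition What := {eq_quot term_equiv}.
HB.instance Definition _ := Choice.on What.
HB.instance Definition _ := EqQuotient.on What.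

Lemma What_eqP (t u : term) : (\pi_What t = \pi_What u) <-> term_eq t u.
Proof. by split=> [/eqmodP/asboolP|h] //; apply/eqmodP/asboolP. Qed.

Lemma repr_pi (t : term) : term_eq (repr (\pi_What t)) t.
Proof. by apply/What_eqP; rewrite reprK. Qed.

Definition What_zero : What := \pi_What TZero.
Definition What_one : What := \pi_What TOne.
Definition What_add := lift_op2 What TAdd.
Definition What_mul := lift_op2 What TMul.
Definition What_scale (a : K) := lift_op1 What (TScale a).
Definition What_opp (w : What) : What := What_scale (-1) w.

Lemma What_addE t u : What_add (\pi_What t) (\pi_What u) = \pi_What (TAdd t u).
Proof. by unlock What_add; apply/What_eqP/TE_add; apply: repr_pi. Qed.
Lemma What_mulE t u : What_mul (\pi_What t) (\pi_What u) = \pi_What (TMul t u).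
Proof. by unlock What_mul; apply/What_eqP/TE_mul; apply: repr_pi. Qed.
Lemma What_scaleE a t : What_scale a (\pi_What t) = \pi_What (TScale a t).
Proof. by unlock What_scale; apply/What_eqP/TE_scale; apply: repr_pi. Qed.

Let WE := (What_addE, What_mulE, What_scaleE).

Lemma What_addA : associative What_add.
Proof. by do 3!elim/quotW=> ?; rewrite !WE; apply/What_eqP; apply: TE_addA. Qed.
Lemma What_addC : commutative What_add.
Proof. by do 2!elim/quotW=> ?; rewrite !WE; apply/What_eqP; apply: TE_addC. Qed.
Lemma What_add0 : left_id What_zero What_add.
Proof. by elim/quotW=> ?; rewrite !WE; apply/What_eqP; apply: TE_add0. Qed.
Lemma What_addN : left_inverse What_zero What_opp What_add.
Proof. by elim/quotW=> ?; rewrite /What_opp !WE; apply/What_eqP; apply: TE_addN. Qed.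
HB.instance Definition _ :=
  GRing.isZmodule.Build What What_addA What_addC What_add0 What_addN.

Lemma What_scaleA a b (w : What) :
  What_scale a (What_scale b w) = What_scale (a * b) w.
Proof. by elim/quotW: w => t; rewrite !WE; apply/What_eqP; apply: TE_scaleA. Qed.
Lemma What_scale1 : left_id 1 What_scale.
Proof. by elim/quotW=> t; rewrite !WE; apply/What_eqP; apply: TE_scale1. Qed.
Lemma What_scaleDr : right_distributive What_scale +%R.
Proof.
by move=> a; do 2!elim/quotW=> ?; rewrite /+%R /= !WE; apply/What_eqP; apply: TE_scaleDr.
Qed.
Lemma What_scaleDl (w : What) : {morph What_scale^~ w : a b / a + b}.
Proof.
move=> a b; elim/quotW: w => t; rewrite [RHS]/+%R /= !WE.
apply/What_eqP; apply: TE_scaleDl.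
Qed.
HB.instance Definition _ := GRing.Zmodule_isLmodule.Build K What
  What_scaleA What_scale1 What_scaleDr What_scaleDl.

(* The augmentation, which shows that What is not the zero ring. *)
Fixpoint term_aug (t : term) : K :=
  match t with
  | TGen _ => 0
  | TZero => 0
  | TOne => 1
  | TAdd t u => term_aug t + term_aug u
  | TScale a t => a * term_aug t
  | TMul t u => term_aug t * term_aug u
  end.

Lemma term_aug_eq t u : term_eq t u -> term_aug t = term_aug u.
Proof.
elim=> /=; try by move=> *; congruence.
- by move=> *; rewrite addrA.
- by move=> *; rewrite addrC.
- by move=> *; rewrite add0r.
- by move=> *; rewrite mulN1r addNr.
- by move=> *; rewrite mulrA.
- by move=> *; rewrite mul1r.
- by move=> *; rewrite mulrDr.
- by move=> *; rewrite mulrDl.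
- by move=> *; rewrite mulrA.
- by move=> *; rewrite mul1r.
- by move=> *; rewrite mulr1.
- by move=> *; rewrite mulrDl.
- by move=> *; rewrite mulrDr.
- by move=> *; rewrite mulrA.
- by move=> *; rewrite mulrCA.
- by move=> *; rewrite !mulr0.
Qed.

Lemma What_mulA : associative What_mul.
Proof. by do 3!elim/quotW=> ?; rewrite !WE; apply/What_eqP; apply: TE_mulA. Qed.
Lemma What_mul1l : left_id What_one What_mul.
Proof. by elim/quotW=> ?; rewrite !WE; apply/What_eqP; apply: TE_mul1l. Qed.
Lemma What_mul1r : right_id What_one What_mul.
Proof. by elim/quotW=> ?; rewrite !WE; apply/What_eqP; apply: TE_mul1r. Qed.
Lemma What_mulDl : left_distributive What_mul +%R.
Proof.
by do 3!elim/quotW=> ?; rewrite /+%R /= !WE; apply/What_eqP; apply: TE_mulDl.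
Qed.
Lemma What_mulDr : right_distributive What_mul +%R.
Proof.
by do 3!elim/quotW=> ?; rewrite /+%R /= !WE; apply/What_eqP; apply: TE_mulDr.
Qed.
Lemma What_1_neq0 : What_one != 0.
Proof.
apply/eqP => /(What_eqP TOne TZero) /term_aug_eq /= /eqP.
by rewrite oner_eq0.
Qed.
HB.instance Definition _ := GRing.Zmodule_isNzRing.Build What
  What_mulA What_mul1l What_mul1r What_mulDl What_mulDr What_1_neq0.

Lemma What_scaleAl a (v w : What) : a *: (v * w) = (a *: v) * w.
Proof.
elim/quotW: v => t; elim/quotW: w => u.
by rewrite /( *:%R) /( *%R) /= !WE; apply/What_eqP; apply: TE_scaleAl.
Qed.
HB.instance Definition _ :=
  GRing.Lmodule_isLalgebra.Build K What What_scaleAl.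

Lemma What_scaleAr a (v w : What) : a *: (v * w) = v * (a *: w).
Proof.
elim/quotW: v => t; elim/quotW: w => u.
by rewrite /( *:%R) /( *%R) /= !WE; apply/What_eqP; apply: TE_scaleAr.
Qed.
HB.instance Definition _ := GRing.Lalgebra_isAlgebra.Build K What What_scaleAr.

Lemma pi_add t u : \pi_What (TAdd t u) = \pi_What t + \pi_What u.
Proof. by rewrite -What_addE. Qed.
Lemma pi_mul t u : \pi_What (TMul t u) = \pi_What t * \pi_What u.
Proof. by rewrite -What_mulE. Qed.
Lemma pi_scale a t : \pi_What (TScale a t) = a *: \pi_What t.
Proof. by rewrite -What_scaleE. Qed.
Lemma pi_zero : \pi_What TZero = 0. Proof. by []. Qed.
Lemma pi_one : \pi_What TOne = 1. Proof. by []. Qed.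
Definition pi_termE := (pi_add, pi_mul, pi_scale, pi_zero, pi_one).

Definition z (g : gen) : What := \pi_What (TGen g).
Definition x (i : 'I_p) (r : int) : What := z (inl i, r).
Definition y (k : 'I_n) (r : int) : What := z (inr k, r).

Lemma xxC i r j s : x i r * x j s = x j s * x i r.
Proof. by rewrite -!pi_mul; apply/What_eqP; apply: TE_xx. Qed.
Lemma xyC i r k s : x i r * y k s = y k s * x i r.
Proof. by rewrite -!pi_mul; apply/What_eqP; apply: TE_xy. Qed.
Lemma yyN k r l s : y k r * y l s = - (y l s * y k r).
Proof. by rewrite -scaleN1r -!pi_mul -pi_scale; apply/What_eqP; apply: TE_yy. Qed.

Definition odd_gen (g : gen) : bool := if g.1 is inr _ then true else false.

(* The parity automorphism: x_i(r) |-> x_i(r), y_k(r) |-> - y_k(r). *)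
Fixpoint term_sigma (t : term) : What :=
  match t with
  | TGen g => (-1) ^+ odd_gen g *: z g
  | TZero => 0
  | TOne => 1
  | TAdd t u => term_sigma t + term_sigma u
  | TScale a t => a *: term_sigma t
  | TMul t u => term_sigma t * term_sigma u
  end.

Lemma term_sigma_eq t u : term_eq t u -> term_sigma t = term_sigma u.
Proof.
elim=> /=; try by move=> *; congruence.
- by move=> *; rewrite addrA.
- by move=> *; rewrite addrC.
- by move=> *; rewrite add0r.
- by move=> *; rewrite scaleN1r addNr.
- by move=> *; rewrite scalerA.
- by move=> *; rewrite scale1r.
- by move=> *; rewrite scalerDr.
- by move=> *; rewrite scalerDl.
- by move=> *; rewrite mulrA.
- by move=> *; rewrite mul1r.
- by move=> *; rewrite mulr1.
- by move=> *; rewrite mulrDl.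
- by move=> *; rewrite mulrDr.
- by move=> *; rewrite scalerAl.
- by move=> *; rewrite scalerAr.
- by move=> i r j s; rewrite /odd_gen /= !expr0 !scale1r; apply: xxC.
- move=> i r k s; rewrite /odd_gen /= expr0 expr1 !scaleN1r !scale1r.
  by rewrite mulrN mulNr; congr (- _); apply: xyC.
- move=> k r l s; rewrite /odd_gen /= !expr1 !scaleN1r !mulrNN.
  exact: yyN.
Qed.

Definition sigma (w : What) : What := term_sigma (repr w).

Lemma sigma_pi t : sigma (\pi_What t) = term_sigma t.
Proof. exact/term_sigma_eq/repr_pi. Qed.

(* The even part of What is spanned by the monomials with an even number of
   factors y_k(r), the odd part by the others. *)
Definition What_homog (b : bool) : {pred What} :=
  fun w => sigma w == (-1) ^+ b *: w.

(* The left partial derivatives, which satisfy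
   d_g (v w) = d_g v w + sigma^{|g|} v d_g w. *)
Fixpoint term_diff (g : gen) (t : term) : What :=
  match t with
  | TGen h => (g == h)%:R
  | TZero => 0
  | TOne => 0
  | TAdd t u => term_diff g t + term_diff g u
  | TScale a t => a *: term_diff g t
  | TMul t u => term_diff g t * \pi_What u
      + (if odd_gen g then term_sigma t else \pi_What t) * term_diff g u
  end.

Lemma term_diff_eq g t u : term_eq t u -> term_diff g t = term_diff g u.
Proof.
have sE t' u' : term_eq t' u' ->
    (if odd_gen g then term_sigma t' else \pi_What t')
      = (if odd_gen g then term_sigma u' else \pi_What u').
  by case: ifP => _ => [/term_sigma_eq|/What_eqP].
elim=> /=; try by move=> *; congruence.
- by move=> t1 t1' u1 u1' /[dup] /What_eqP ht /sE -> -> /What_eqP -> ->.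
- by move=> *; rewrite addrA.
- by move=> *; rewrite addrC.
- by move=> *; rewrite add0r.
- by move=> *; rewrite scaleN1r addNr.
- by move=> *; rewrite scalerA.
- by move=> *; rewrite scale1r.
- by move=> *; rewrite scalerDr.
- by move=> *; rewrite scalerDl.
- move=> t1 u1 v1; rewrite !pi_termE mulrDr mulrDl !mulrA -!addrA.
  by case: ifP => _; rewrite ?pi_termE.
- by move=> t1; rewrite mul0r add0r pi_termE if_same mul1r.
- by move=> t1; rewrite mulr0 addr0 pi_termE mulr1.
- move=> t1 u1 v1; rewrite !pi_termE mulrDl -!addrA; congr (_ + _).
  by case: ifP => _; rewrite ?pi_termE mulrDl addrCA.
- move=> t1 u1 v1; rewrite !pi_termE !mulrDr -!addrA; congr (_ + _).
  by rewrite addrCA.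
- move=> a t1 u1; rewrite scalerDr !scalerAl; congr (_ + _).
  by case: ifP => _; rewrite ?pi_termE.
- move=> a t1 u1; rewrite scalerDr pi_termE -!scalerAr; congr (_ + _).
- move=> i r j s; rewrite /odd_gen; case: g {sE} => [[k|k] q] /=.
    by rewrite addrC; congr (_ + _); rewrite ?(mulr_natl, mulr_natr).
  by rewrite !mul0r !mulr0.
- move=> i r j s; rewrite /odd_gen; case: g {sE} => [[k|k] q] /=.
    by rewrite mulr0 addr0 mul0r add0r mulr_natl mulr_natr.
  by rewrite expr0 scale1r mulr0 mul0r addr0 add0r mulr_natl mulr_natr.
- move=> i r j s; rewrite /odd_gen; case: g {sE} => [[k|k] q] /=.
    by rewrite !mul0r !mulr0 addr0 scaler0.
  rewrite expr1 !scaleN1r opprD addrC !mulNr opprK.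
  by rewrite !mulr_natl !mulr_natr.
Qed.

Definition diff (g : gen) (w : What) : What := term_diff g (repr w).

Lemma diff_pi g t : diff g (\pi_What t) = term_diff g t.
Proof. exact/term_diff_eq/repr_pi. Qed.

Lemma diff_z g h : diff g (z h) = (g == h)%:R.
Proof. exact: diff_pi. Qed.

Lemma diffM g v w :
  diff g (v * w) = diff g v * w + (if odd_gen g then sigma v else v) * diff g w.
Proof.
elim/quotW: v => t; elim/quotW: w => u.
by rewrite -pi_mul !diff_pi sigma_pi.
Qed.

Definition diff_x (i : 'I_p) (r : int) : What -> What := diff (inl i, r).
Definition diff_y (k : 'I_n) (r : int) : What -> What := diff (inr k, r).

Variable mu : K.

Definition e11 (r : int) (w : What) : What :=
  (if r == 0 then mu else 0) *: w
  - \sum_(s \in [set: int]) \sum_(i < p) x i (r + s) * diff_x i s w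
  - \sum_(s \in [set: int]) \sum_(k < n) y k (r + s) * diff_y k s w.

(* [None] is the index 1, [Some (inl i)] the index i + 2 <= m and [Some (inr k)]
   the index m + k + 1, for i and k counted from 0. *)
Definition index_kind (i : 'I_(p.+1 + n)) : option ('I_p + 'I_n) :=
  match fintype.split i with
  | inl i0 => omap inl (unlift ord0 i0)
  | inr k => Some (inr k)
  end.

(* In the last case, a and b each range over the x and the y generators. *)
Definition e (i j : 'I_(p.+1 + n)) (r : int) (w : What) : What :=
  match index_kind i, index_kind j with
  | None, None => e11 r w
  | None, Some b => \sum_(s \in [set: int]) e11 (r + s) (diff (b, s) w)
  | Some a, None => z (a, r) * w
  | Some a, Some b => \sum_(s \in [set: int]) z (a, r + s) * diff (b, s) w
  end.

Definition D (w : What) : What :=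
  \sum_(i < p) \sum_(r \in [set: int]) r%:~R *: (x i r * diff_x i r w)
  + \sum_(k < n) \sum_(r \in [set: int]) r%:~R *: (y k r * diff_y k r w).

(* K acts as 0, so that [K_part u] does not occur. *)
Definition ghat_act (u : ghat K p n) (w : What) : What :=
  \sum_(r \in [set: int]) \sum_i \sum_j loop_part u r i j *: e i j r w
  + d_part u *: D w.

End Presentation.

(* Main.v *)
From HB Require Import structures.
Require Import Defs.
From mathcomp Require Import all_boot all_order all_algebra.
From mathcomp Require Import ssrAC.
From mathcomp Require Import boolp classical_sets functions cardinality fsbigop.
From mathcomp Require Import ring zify.
From mathcomp Require Import reals complex.

(* Left multiplications by the generators are the operators of E_{a,1} t^q, and
   every operator e_{i,j}(r) has a commutator with them that is again of the form
   e(r + q).  Hence an identity [rho X, rho Y] = rho [X, Y] passes from w to z w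
   by the Jacobi identity in gl_{m|n}, and it is enough to check it on 1.

   For irreducibility, the e_{1,b}(r) lower the degree.  If they all kill w, then
   for r large the term mu d_{b,-r} w of e_{1,b}(r) w vanishes while the products
   z_a(r + t) that occur in the rest involve only generators absent from w, so
   their coefficients \sum_{s + s' = t} d_{a,s'} d_{b,s} w vanish.  These do not
   depend on r, so mu d_{b,-r} w = 0 for all r, and w is a scalar.  Thus every
   nonzero submodule contains 1, which generates the module. *)

Set Implicit Arguments.
Unset Strict Implicit.
Unset Printing Implicit Defensive.

Import Order.TTheory GRing.Theory Num.Theory.
Local Open Scope ring_scope.
Local Open Scope quotient_scope.

(** * Sums with finite support *)

Section FiniteSums.
Variables (I : choiceType) (V : zmodType).
Implicit Types (F G : I -> V).

Definition fin_supp F := exists s : seq I, forall r, r \notin s -> F r = 0.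

(** Any duplicate-free list that contains the support will do, so several sums can be computed over
    one common list. *)
Lemma fsumE (s : seq I) F : uniq s -> (forall r, r \notin s -> F r = 0) ->
  \sum_(r \in [set: I]) F r = \sum_(r <- s) F r.
Proof.
move=> us F0; rewrite (@fsbigE _ _ _ _ _ s) //; last by move=> r _ /F0.
by apply: eq_bigl => r; rewrite in_setT.
Qed.

Lemma fin_supp_uniq F : fin_supp F ->
  exists2 s : seq I, uniq s & forall r, r \notin s -> F r = 0.
Proof.
move=> [s sF]; exists (undup s); first exact: undup_uniq.
by move=> r; rewrite mem_undup; apply: sF.
Qed.

Lemma fin_suppD F G : fin_supp F -> fin_supp G ->
  fin_supp (fun r => F r + G r).
Proof.
move=> [s sF] [t tG]; exists (s ++ t) => r.
by rewrite mem_cat negb_or => /andP[/sF -> /tG ->]; rewrite addr0.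
Qed.

Lemma fin_supp_sum (J : Type) (t : seq J) (P : pred J) (F : J -> I -> V) :
  (forall j, fin_supp (F j)) -> fin_supp (fun r => \sum_(j <- t | P j) F j r).
Proof.
move=> sF; elim: t => [|j t IH].
  by exists [::] => r _; rewrite big_nil.
have [s sH] := fin_suppD (sF j) IH; have [s' sH'] := IH.
exists (s ++ s') => r; rewrite mem_cat negb_or => /andP[/sH h /sH' h'].
by rewrite big_cons; case: ifP.
Qed.

(** A sum with infinite support is 0 by convention, so both supports must be known to be finite
    before the sum is split. *)
Lemma fsumD F G : fin_supp F -> fin_supp G ->
  \sum_(r \in [set: I]) (F r + G r)
    = \sum_(r \in [set: I]) F r + \sum_(r \in [set: I]) G r.
Proof.
move=> [s sF] [t tG]; set u := undup (s ++ t).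
have uF r : r \notin u -> F r = 0.
  by rewrite mem_undup mem_cat negb_or => /andP[/sF].
have uG r : r \notin u -> G r = 0.
  by rewrite mem_undup mem_cat negb_or => /andP[_ /tG].
rewrite !(fsumE (s := u)) ?undup_uniq ?big_split //.
by move=> r ru; rewrite uF ?uG ?addr0.
Qed.

Lemma fsumN F : fin_supp F ->
  \sum_(r \in [set: I]) - F r = - \sum_(r \in [set: I]) F r.
Proof.
move=> /fin_supp_uniq [s us sF]; rewrite !(fsumE us) ?sumrN //.
by move=> r /sF ->; rewrite oppr0.
Qed.

Lemma fsum_sum (J : Type) (t : seq J) (F : J -> I -> V) :
  (forall j, fin_supp (F j)) ->
  \sum_(r \in [set: I]) \sum_(j <- t) F j r
    = \sum_(j <- t) \sum_(r \in [set: I]) F j r.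
Proof.
move=> sF; elim: t => [|j t IH].
  by rewrite big_nil fsbig1 // => r _; rewrite big_nil.
rewrite big_cons -IH -fsumD //; last exact: fin_supp_sum.
by apply: eq_fsbigr => r _; rewrite big_cons.
Qed.

End FiniteSums.

Lemma fin_supp_sub (I : choiceType) (V W : zmodType) (F : I -> V) (G : I -> W) :
  (forall r, F r = 0 -> G r = 0) -> fin_supp F -> fin_supp G.
Proof. by move=> FG [s sF]; exists s => r /sF /FG. Qed.

Lemma fsumZ (I : choiceType) (K : pzRingType) (V : lmodType K) (k : K) (F : I -> V) :
  fin_supp F ->
  \sum_(r \in [set: I]) k *: F r = k *: \sum_(r \in [set: I]) F r.
Proof.
move=> /fin_supp_uniq [s us sF]; rewrite !(fsumE us) ?scaler_sumr //.
by move=> r /sF ->; rewrite scaler0.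
Qed.

Lemma fsumMl (I : choiceType) (R : pzRingType) (k : R) (F : I -> R) :
  fin_supp F ->
  \sum_(r \in [set: I]) k * F r = k * \sum_(r \in [set: I]) F r.
Proof.
move=> /fin_supp_uniq [s us sF]; rewrite !(fsumE us) ?mulr_sumr //.
by move=> r /sF ->; rewrite mulr0.
Qed.

Lemma raddf_fsum (I : choiceType) (V W : zmodType) (f : {additive V -> W})
    (F : I -> V) : fin_supp F ->
  f (\sum_(r \in [set: I]) F r) = \sum_(r \in [set: I]) f (F r).
Proof.
move=> /fin_supp_uniq [s us sF]; rewrite !(fsumE us) ?raddf_sum //.
by move=> r /sF ->; rewrite raddf0.
Qed.

(** * Derivatives, and how the basic operators commute with generators *)

Section Operators.
Variables (K : numFieldType) (p n : nat).
Local Notation W := (What K p n).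
Implicit Types (v w : W) (g h : gen p n) (r s : int).

(** Words in the generators span [What]. This induction replaces a monomial basis: an operator
    identity follows from its value on 1 and its behaviour under left multiplication by a
    generator. *)
Lemma What_ind (P : W -> Prop) :
  P 1 -> (forall a v w, P v -> P w -> P (a *: v + w)) ->
  (forall g w, P w -> P (z K g * w)) -> forall w, P w.
Proof.
move=> P1 PD Pz w.
have P0 : P 0.
  have -> : (0 : W) = (-1) *: 1 + 1 by rewrite scaleN1r addNr.
  exact: PD.
(* With an arbitrary right factor [v], the case of a product applies the two induction hypotheses
   one after the other. *)
suff H : forall t v, P v -> P (\pi_W t * v).
  by rewrite -[w]mulr1 -[w]reprK; apply: H.
elim=> [g|||t IHt u IHu|a t IHt|t IHt u IHu] v Pv; rewrite ?pi_termE.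
- exact: Pz.
- by rewrite mul0r.
- by rewrite mul1r.
- by rewrite mulrDl -[X in P (X + _)]scale1r; apply: PD; [apply: IHt|apply: IHu].
- rewrite -scalerAl -[X in P X]addr0; apply: PD => //; exact: IHt.
- by rewrite -mulrA; apply: IHt; apply: IHu.
Qed.

Lemma sigma_is_linear : linear (@sigma K p n).
Proof.
move=> a v w; elim/quotW: v => t; elim/quotW: w => u.
by rewrite -Defs.pi_scale -Defs.pi_add !sigma_pi.
Qed.
HB.instance Definition _ :=
  GRing.isLinear.Build K W W *:%R (@sigma K p n) sigma_is_linear.

Lemma diff_is_linear g : linear (@diff K p n g).
Proof.
move=> a v w; elim/quotW: v => t; elim/quotW: w => u.
by rewrite -Defs.pi_scale -Defs.pi_add !diff_pi.
Qed.
HB.instance Definition _ g :=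
  GRing.isLinear.Build K W W *:%R (@diff K p n g) (diff_is_linear g).

Lemma sigma1 : sigma (1 : W) = 1.
Proof. by rewrite -Defs.pi_one sigma_pi. Qed.

Lemma sigmaM v w : sigma (v * w) = sigma v * sigma w.
Proof.
elim/quotW: v => t; elim/quotW: w => u.
by rewrite -Defs.pi_mul !sigma_pi.
Qed.

Lemma sigma_z g : sigma (z K g) = (-1) ^+ odd_gen g *: z K g.
Proof. by rewrite sigma_pi. Qed.

Lemma diff1 g : diff g (1 : W) = 0.
Proof. by rewrite -Defs.pi_one diff_pi. Qed.

(** One sign rule for the three families of relations, so that later arguments need not distinguish
    x from y. *)
Lemma zC g h : z K g * z K h = (-1) ^+ (odd_gen g && odd_gen h) *: (z K h * z K g).
Proof.
case: g h => [[i|k] r] [[j|l] s]; rewrite /odd_gen /= ?expr0 ?expr1 ?scale1r.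
- exact: xxC.
- exact: xyC.
- by apply/esym; apply: xyC.
- by rewrite scaleN1r; apply: yyN.
Qed.

Lemma sigmaK : involutive (@sigma K p n).
Proof.
elim/What_ind => [|a v w Hv Hw|g w Hw].
- by rewrite !sigma1.
- by rewrite !(linearD, linearZ) /= Hv Hw.
- by rewrite !sigmaM Hw sigma_z linearZ /= sigma_z scalerA -signr_addb addbb scale1r.
Qed.

Lemma diff_zM g h w : diff g (z K h * w) =
  (g == h)%:R *: w + (-1) ^+ (odd_gen g && odd_gen h) *: (z K h * diff g w).
Proof.
rewrite diffM diff_z scaler_nat mulr_natl; congr (_ + _).
case: (odd_gen g); rewrite ?sigma_z /= ?scale1r //.
by rewrite -scalerAl.
Qed.

(** Both sides vanish on 1 and obey the same Leibniz recursion against a generator; the delta terms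
    match because a sign squares to 1. *)
Lemma diffC g h w : diff g (diff h w) =
  (-1) ^+ (odd_gen g && odd_gen h) *: diff h (diff g w).
Proof.
elim/What_ind: w => [|a v w Hv Hw|k w Hw].
- by rewrite !diff1 !linear0.
- by rewrite !(linearD, linearZ) /= Hv Hw.
rewrite !diff_zM !linearD !linearZ /= !diff_zM Hw -scalerAr !scalerDr !scalerA.
rewrite addrCA !addrA; congr (_ *: _ + _ *: _ + _ *: _).
- have [->|_] := eqVneq g k; last by rewrite mul0r mulr0.
  by rewrite mul1r mulr1 andbC.
- have [->|_] := eqVneq h k; last by rewrite !mulr0.
  by rewrite !mulr1 -signr_addb addbb.
- by rewrite -mulrA mulrC.
Qed.

Implicit Types (a b c : 'I_p + 'I_n).

Definition odd_letter a : bool := if a is inr _ then true else false.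

(** An element involves finitely many generators; every infinite sum in the action is finite for
    this reason. *)
Lemma fin_supp_diff b w : fin_supp (fun s => diff (b, s) w).
Proof.
elim/What_ind: w => [|k v w [s sv] [t tw]|[c q] w [s sH]].
- by exists [::] => r _; rewrite diff1.
- exists (s ++ t) => r; rewrite mem_cat negb_or => /andP[/sv vr /tw wr].
  by rewrite linearP /= vr wr scaler0 addr0.
exists (q :: s) => r; rewrite inE negb_or => /andP[rq /sH rs].
by rewrite diff_zM rs mulr0 scaler0 addr0 xpair_eqE (negPf rq) andbF scale0r.
Qed.

(** The operator of $E_{a,b}\otimes t^r$ for two letters; its diagonal cases also make up [e11] and
    the Euler operator. *)
Definition shift_op a b r w : W :=
  \sum_(s \in [set: int]) z K (a, r + s) * diff (b, s) w.

Lemma fin_supp_shift a b r w : fin_supp (fun s => z K (a, r + s) * diff (b, s) w).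
Proof. by apply: fin_supp_sub (fin_supp_diff b w) => s ->; rewrite mulr0. Qed.
Hint Resolve fin_supp_shift fin_supp_diff : core.

Lemma shift_op_is_linear a b r : linear (shift_op a b r).
Proof.
move=> k v w; rewrite -fsumZ // -fsumD //; last first.
  by apply: fin_supp_sub (fin_supp_shift a b r v) => s ->; rewrite scaler0.
by apply: eq_fsbigr => s _; rewrite linearP mulrDr scalerAr.
Qed.
HB.instance Definition _ a b r :=
  GRing.isLinear.Build K W W *:%R (shift_op a b r) (shift_op_is_linear a b r).

Lemma shift_op1 a b r : shift_op a b r 1 = 0.
Proof. by apply: fsbig1 => s _; rewrite diff1 mulr0. Qed.

(** [P] holds at [q] or nowhere. Keeping the factor [(P q)%:R] lets one formula serve equal and
    distinct letters. *)
Lemma fsum_deltaP (P : pred int) (F : int -> W) q : (forall s, P s -> s = q) ->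
  \sum_(s \in [set: int]) (P s)%:R *: F s = (P q)%:R *: F q.
Proof.
move=> Pq; rewrite (fsumE (s := [:: q])) //; first by rewrite big_seq1.
move=> s; rewrite inE; have [/Pq ->|] := boolP (P s); first by rewrite eqxx.
by rewrite scale0r.
Qed.

Lemma fin_supp_delta (P : pred int) (F : int -> W) q : (forall s, P s -> s = q) ->
  fin_supp (fun s => (P s)%:R *: F s).
Proof.
move=> Pq; exists [:: q] => s; rewrite inE => sq.
have [/Pq sE|_] := boolP (P s); last by rewrite scale0r.
by rewrite sE eqxx in sq.
Qed.

Lemma pair_letter_eq b c q s : (b, s) == (c, q) -> s = q.
Proof. by case/andP=> _ /eqP. Qed.

(** By the Leibniz rule only the summand [s = q] with [b = c] produces a delta term; moving
    [z K (c, q)] to the front past [z K (a, r + s)] and the derivative gives the sign. *)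
Lemma shift_op_zM a b r c q w : shift_op a b r (z K (c, q) * w) =
  (b == c)%:R *: (z K (a, r + q) * w)
  + (-1) ^+ ((odd_letter a (+) odd_letter b) && odd_letter c)
    *: (z K (c, q) * shift_op a b r w).
Proof.
rewrite -fsumMl // -fsumZ; last first.
  by apply: fin_supp_sub (fin_supp_shift a b r w) => s ->; rewrite mulr0.
have -> : (b == c)%:R = ((b, q) == (c, q))%:R :> K by rewrite xpair_eqE eqxx andbT.
rewrite -(fsum_deltaP (fun s => z K (a, r + s) * w) (@pair_letter_eq b c q)).
rewrite -fsumD.
- apply: eq_fsbigr => s _; rewrite diff_zM mulrDr -!scalerAr; congr (_ + _).
  rewrite !mulrA zC -!scalerAl scalerA andb_addl signr_addb mulrC.
  by [].
- exact: fin_supp_delta (@pair_letter_eq b c q).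
by apply: fin_supp_sub (fin_supp_shift a b r w) => s ->; rewrite mulr0 scaler0.
Qed.

Variable mu : K.

Lemma e11E r w :
  e11 mu r w = (mu *+ (r == 0)) *: w - \sum_a shift_op a a r w.
Proof.
rewrite /e11 mulrb -addrA -opprD; congr (_ - _).
rewrite big_sumType /=.
have E (J : finType) (f : J -> 'I_p + 'I_n) :
    \sum_(s \in [set: int]) \sum_(i : J) z K (f i, r + s) * diff (f i, s) w
    = \sum_(i : J) shift_op (f i) (f i) r w.
  by rewrite fsum_sum.
by rewrite -!E.
Qed.

Lemma e11_is_linear r : linear (@e11 K p n mu r).
Proof.
move=> k v w; rewrite !e11E scalerBr scaler_sumr.
have -> : \sum_a shift_op a a r (k *: v + w) =
    \sum_a k *: shift_op a a r v + \sum_a shift_op a a r w.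
  by rewrite -big_split; apply: eq_bigr => a _; rewrite linearP.
by rewrite scalerDr !scalerA [k * _]mulrC opprD addrACA.
Qed.
HB.instance Definition _ r :=
  GRing.isLinear.Build K W W *:%R (@e11 K p n mu r) (e11_is_linear r).

Lemma e11_1 r : e11 mu r (1 : W) = (mu *+ (r == 0)) *: 1.
Proof. by rewrite e11E big1 ?subr0 // => a _; rewrite shift_op1. Qed.

(** Each [shift_op a a r] is even, so no sign appears, and only [a = c] contributes a delta term. *)
Lemma e11_zM r c q w : e11 mu r (z K (c, q) * w) =
  z K (c, q) * e11 mu r w - z K (c, r + q) * w.
Proof.
rewrite !e11E mulrBr -scalerAr -addrA -opprD; congr (_ - _).
under eq_bigr do rewrite shift_op_zM addbb expr0 scale1r.
rewrite big_split /= -mulr_sumr addrC; congr (_ + _).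
rewrite (bigD1 c) //= eqxx scale1r big1 ?addr0 // => a /negPf ->.
by rewrite scale0r.
Qed.

(** The operator of $E_{1,b}\otimes t^r$, which lowers the degree by one. *)
Definition lower_op b r w : W := \sum_(s \in [set: int]) e11 mu (r + s) (diff (b, s) w).

Lemma fin_supp_lower b r w : fin_supp (fun s => e11 mu (r + s) (diff (b, s) w)).
Proof. by apply: fin_supp_sub (fin_supp_diff b w) => s ->; rewrite linear0. Qed.
Hint Resolve fin_supp_lower : core.

Lemma lower_op_is_linear b r : linear (lower_op b r).
Proof.
move=> k v w; rewrite -fsumZ // -fsumD //; last first.
  by apply: fin_supp_sub (fin_supp_lower b r v) => s ->; rewrite scaler0.
by apply: eq_fsbigr => s _; rewrite !linearP.
Qed.
HB.instance Definition _ b r :=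
  GRing.isLinear.Build K W W *:%R (lower_op b r) (lower_op_is_linear b r).

Lemma lower_op1 b r : lower_op b r 1 = 0.
Proof. by apply: fsbig1 => s _; rewrite diff1 linear0. Qed.

(** Combines the Leibniz rule with [e11_zM]; it reflects $[E_{1,b},E_{c,1}]=\delta_{b,c}E_{1,1}\mp
    E_{c,b}$, with the modes added. *)
Lemma lower_op_zM b r c q w : lower_op b r (z K (c, q) * w) =
  (b == c)%:R *: e11 mu (r + q) w
  + (-1) ^+ (odd_letter b && odd_letter c)
    *: (z K (c, q) * lower_op b r w - shift_op c b (r + q) w).
Proof.
rewrite -fsumMl //.
have -> : shift_op c b (r + q) w
    = \sum_(s \in [set: int]) z K (c, r + s + q) * diff (b, s) w.
  by apply: eq_fsbigr => s _; rewrite addrAC.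
have fs1 : fin_supp (fun s => z K (c, q) * e11 mu (r + s) (diff (b, s) w)).
  by apply: fin_supp_sub (fin_supp_diff b w) => s ->; rewrite linear0 mulr0.
have fs2 : fin_supp (fun s => - (z K (c, r + s + q) * diff (b, s) w)).
  by apply: fin_supp_sub (fin_supp_diff b w) => s ->; rewrite mulr0 oppr0.
have fs3 := fin_suppD fs1 fs2.
rewrite -fsumN; last first.
  by apply: fin_supp_sub (fin_supp_diff b w) => s ->; rewrite mulr0.
rewrite -fsumD // -fsumZ //.
have -> : (b == c)%:R = ((b, q) == (c, q))%:R :> K by rewrite xpair_eqE eqxx andbT.
rewrite -(fsum_deltaP (fun s => e11 mu (r + s) w) (@pair_letter_eq b c q)).
rewrite -fsumD.
- apply: eq_fsbigr => s _; rewrite diff_zM linearP linearZ /= e11_zM.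
  by [].
- exact: fin_supp_delta (@pair_letter_eq b c q).
by apply: fin_supp_sub fs3 => s ->; rewrite scaler0.
Qed.
End Operators.

(** * Matrices acting at a fixed mode *)

Section GlAction.
Variables (K : numFieldType) (p n : nat) (mu : K).
Local Notation W := (What K p n).
Local Notation gl := 'M[K]_(p.+1 + n).
Local Notation I := 'I_(p.+1 + n).
Implicit Types (v w : W) (g h : gen p n) (r s q : int) (i j k l : I).
Implicit Types (a b c : 'I_p + 'I_n) (A B C : gl).

Definition index_of (o : option ('I_p + 'I_n)) : I :=
  match o with
  | None => lshift n ord0
  | Some (inl i) => lshift n (lift ord0 i)
  | Some (inr k) => rshift p.+1 k
  end.

Lemma index_ofK : cancel index_of (@index_kind p n).
Proof.
rewrite /index_kind; case=> [[i|k]|] /=.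
- by rewrite (unsplitK (inl (lift ord0 i))) liftK.
- by rewrite (unsplitK (inr k)).
- by rewrite (unsplitK (inl ord0)) unlift_none.
Qed.

Lemma index_kindK : cancel (@index_kind p n) index_of.
Proof.
move=> i; rewrite /index_kind -[RHS]splitK; case: (fintype.split i) => [j|k] //=.
by case: unliftP => [j' ->|->].
Qed.

Lemma index_kind_inj : injective (@index_kind p n).
Proof. exact: can_inj index_kindK. Qed.

Definition first_index : I := index_of None.
Definition letter_index a : I := index_of (Some a).

Lemma odd_indexE i : odd_index i = oapp (@odd_letter p n) false (index_kind i).
Proof.
rewrite -{1}(index_kindK i) /odd_index.
case: (index_kind i) => [[j|k]|] //=; last by rewrite leq_addr.
by apply/negbTE; rewrite -ltnNge; apply: (ltn_ord (lift ord0 j)).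
Qed.

Lemma odd_letter_index c : odd_index (letter_index c) = odd_letter c.
Proof. by rewrite odd_indexE index_ofK. Qed.

Lemma odd_first_index : odd_index first_index = false.
Proof. by rewrite odd_indexE index_ofK. Qed.

Lemma e_is_linear i j r : linear (@e K p n mu i j r).
Proof.
rewrite /e => x v w; case: (index_kind i) (index_kind j) => [a|] [b|].
- exact: (linearP (shift_op a b r)).
- by rewrite mulrDr scalerAr.
- exact: (linearP (lower_op mu b r)).
- exact: linearP.
Qed.
HB.instance Definition _ i j r :=
  GRing.isLinear.Build K W W *:%R (@e K p n mu i j r) (e_is_linear i j r).

(** A uniform form of the four commutation rules: the correction is the image of
    $[E_{i,j},E_{c,1}]\otimes t^{r+q}$, where [z K (c, q)] is the operator of $E_{c,1}\otimes
    t^q$. *)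
Lemma e_zM i j r c q w :
  let sg : K := (-1) ^+ ((odd_index i (+) odd_index j) && odd_letter c) in
  e mu i j r (z K (c, q) * w) = sg *: (z K (c, q) * e mu i j r w)
    + ((j == letter_index c)%:R *: e mu i first_index (r + q) w
       - (i == first_index)%:R *: (sg *: e mu (letter_index c) j (r + q) w)).
Proof.
have eq_index k o : (k == index_of o) = (index_kind k == o).
  by rewrite -(inj_eq index_kind_inj) index_ofK.
rewrite /letter_index /first_index !eq_index !odd_indexE /e !index_ofK.
case: (index_kind i) (index_kind j) => [a|] [b|] /=.
- by rewrite scale0r subr0 addrC (inj_eq (@Some_inj _)); apply: shift_op_zM.
- by rewrite !scale0r subr0 addr0 addbF !mulrA zC -scalerAl.
- by rewrite scale1r [RHS]addrCA -scalerBr (inj_eq (@Some_inj _)); apply: lower_op_zM.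
- by rewrite scale0r add0r expr0 !scale1r; apply: e11_zM.
Qed.

Definition gl_act A r w : W := \sum_i \sum_j A i j *: e mu i j r w.

Lemma act_is_linear A r : linear (gl_act A r).
Proof.
move=> x v w; rewrite /gl_act scaler_sumr -big_split; apply: eq_bigr => i _ /=.
rewrite scaler_sumr -big_split; apply: eq_bigr => j _ /=.
by rewrite linearP scalerDr !scalerA mulrC.
Qed.
HB.instance Definition _ A r :=
  GRing.isLinear.Build K W W *:%R (gl_act A r) (act_is_linear A r).

Lemma act_linearl x A B r w : gl_act (x *: A + B) r w = x *: gl_act A r w + gl_act B r w.
Proof.
rewrite /gl_act scaler_sumr -big_split; apply: eq_bigr => i _ /=.
rewrite scaler_sumr -big_split; apply: eq_bigr => j _ /=.
by rewrite !mxE scalerDl scalerA.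
Qed.

Lemma act0l r w : gl_act 0 r w = 0.
Proof. by rewrite /gl_act big1 // => i _; rewrite big1 // => j _; rewrite mxE scale0r. Qed.

Lemma actDl A B r w : gl_act (A + B) r w = gl_act A r w + gl_act B r w.
Proof. by rewrite -[A]scale1r act_linearl !scale1r. Qed.

Lemma actZl x A r w : gl_act (x *: A) r w = x *: gl_act A r w.
Proof. by rewrite -[x *: A]addr0 act_linearl act0l addr0. Qed.

Lemma actBl A B r w : gl_act (A - B) r w = gl_act A r w - gl_act B r w.
Proof. by rewrite -scaleN1r actDl actZl scaleN1r. Qed.

Lemma act_delta i j r w : gl_act (delta_mx i j) r w = e mu i j r w.
Proof.
rewrite /gl_act (bigD1 i) //= (bigD1 j) //= mxE !eqxx scale1r !big1 ?addr0 //.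
- move=> i' /negPf i'i; rewrite big1 // => j' _.
  by rewrite mxE i'i scale0r.
- by move=> j' /negPf j'j; rewrite mxE j'j andbF scale0r.
Qed.

Definition homog (t : bool) A := gl_part t A = A.

(** A homogeneous matrix is a combination of the matrix units of its parity, so linear statements
    reduce to those units. *)
Lemma homog_ind (t : bool) (Q : gl -> Prop) :
  Q 0 -> (forall x A B, Q A -> Q B -> Q (x *: A + B)) ->
  (forall i j, odd_index i (+) odd_index j = t -> Q (delta_mx i j)) ->
  forall A, homog t A -> Q A.
Proof.
move=> Q0 QD Qd A <-.
have QS (J : Type) (u : seq J) (F : J -> gl) :
    (forall x, Q (F x)) -> Q (\sum_(i <- u) F i).
  move=> QF; apply: (big_ind Q) => // B C QB QC.
  by rewrite -[B]scale1r; apply: QD.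
rewrite [gl_part t A]matrix_sum_delta.
apply: (QS) => i; apply: (QS) => j; rewrite mxE.
case: eqP => [ij|_]; last by rewrite scale0r.
by rewrite -[_ *: _]addr0; apply: QD => //; apply: Qd.
Qed.

Lemma homogP (t : bool) A :
  homog t A <-> (forall i j, odd_index i (+) odd_index j != t -> A i j = 0).
Proof.
split=> [<- i j /negPf ij|H]; first by rewrite mxE ij.
apply/matrixP=> i j; rewrite mxE; case: eqP => // /eqP ij.
by rewrite H.
Qed.

Lemma homog_delta i j : homog (odd_index i (+) odd_index j) (delta_mx i j).
Proof.
apply/homogP => i' j' ij; rewrite mxE; case: eqP => //= i'i; case: eqP => //= j'j.
by rewrite i'i j'j eqxx in ij.
Qed.

Lemma homogD t A B : homog t A -> homog t B -> homog t (A + B).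
Proof.
by move=> /homogP hA /homogP hB; apply/homogP => i j ij; rewrite mxE hA ?hB ?addr0.
Qed.

Lemma homogZ t x A : homog t A -> homog t (x *: A).
Proof.
by move=> /homogP hA; apply/homogP => i j ij; rewrite mxE hA ?mulr0.
Qed.

Lemma homogM t u A B : homog t A -> homog u B -> homog (t (+) u) (A *m B).
Proof.
move=> /homogP hA /homogP hB; apply/homogP => i j ij.
rewrite mxE big1 // => k _.
have [ik|/hA->] := eqVneq (odd_index i (+) odd_index k) t; last by rewrite mul0r.
rewrite hB ?mulr0 //; apply: contraNneq ij => <-.
by rewrite -ik addbA addbK.
Qed.

(** The supercommutator with its sign as a parameter, to be taken as the product of the two
    parities. *)
Definition scomm (t : bool) A B : gl := A *m B - (-1) ^+ t *: (B *m A).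

Lemma homog_scomm t u x A B : homog t A -> homog u B -> homog (t (+) u) (scomm x A B).
Proof.
move=> hA hB; apply: homogD; first exact: homogM.
by rewrite -scaleN1r; do 2!apply: homogZ; rewrite addbC; apply: homogM.
Qed.

(** Linear extension of [e_zM]: the bracket relation between $A\otimes t^r$ and $E_{c,1}\otimes
    t^q$, and the source of every inductive step on words. *)
Lemma act_zM t A r c q w : homog t A ->
  gl_act A r (z K (c, q) * w) =
    (-1) ^+ (t && odd_letter c) *: (z K (c, q) * gl_act A r w)
    + gl_act (scomm (t && odd_letter c) A
                (delta_mx (letter_index c) first_index)) (r + q) w.
Proof.
move=> hA; move: A hA; apply: homog_ind.
- by rewrite !act0l mulr0 scaler0 add0r /scomm mul0mx mulmx0 scaler0 subr0 act0l.
- move=> x A B hA hB; rewrite !act_linearl hA hB.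
  rewrite /scomm mulmxDl mulmxDr -scalemxAl -scalemxAr !actBl !actZl !actDl !actZl.
  rewrite mulrDr -scalerAr !scalerDr !scalerN !scalerA ![x * _]mulrC opprD.
  by rewrite addrACA; congr (_ + _); rewrite addrACA.
move=> i j <-; rewrite !act_delta e_zM /scomm actBl actZl !mul_delta_mx_cond.
congr (_ + (_ - _)).
  by case: (j == _); rewrite ?scale0r ?act0l // scale1r act_delta.
rewrite eq_sym; case: (_ == i); rewrite ?scale0r ?act0l ?scaler0 //.
by rewrite !scale1r act_delta.
Qed.

End GlAction.

(** * The bracket relations for matrices at fixed modes *)

Section Module.
Variables (K : numFieldType) (p n : nat) (mu : K).
Local Notation W := (What K p n).
Local Notation gl := 'M[K]_(p.+1 + n).
Local Notation act := (@gl_act K p n mu).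
Local Notation letter_index := (@letter_index p n).
Local Notation first_index := (@first_index p n).
Implicit Types (v w : W) (g h : gen p n) (r s q : int).
Implicit Types (i j k l : 'I_(p.+1 + n)) (a b c : 'I_p + 'I_n).
Implicit Types (A B C : gl) (f : loop K p n).

Lemma scomm_linearl t B x A A' : scomm t (x *: A + A') B = x *: scomm t A B + scomm t A' B.
Proof.
rewrite /scomm mulmxDl mulmxDr -scalemxAl -scalemxAr scalerBr !scalerDr !scalerA.
by rewrite [x * _]mulrC opprD addrACA.
Qed.

Lemma scomm_linearr t B x A A' : scomm t B (x *: A + A') = x *: scomm t B A + scomm t B A'.
Proof.
rewrite /scomm mulmxDl mulmxDr -scalemxAl -scalemxAr scalerBr !scalerDr !scalerA.
by rewrite [x * _]mulrC opprD addrACA.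
Qed.

Lemma scomm0l t B : scomm t 0 B = 0.
Proof. by rewrite /scomm mul0mx mulmx0 scaler0 subr0. Qed.

Lemma scomm0r t B : scomm t B 0 = 0.
Proof. by rewrite /scomm mul0mx mulmx0 scaler0 subr0. Qed.

(** The super Jacobi identity solved for $[[A,B],C]$, the form in which [act_bracket] uses it with
    $C=E_{c,1}$. *)
Lemma scomm_jacobi t u x A B C :
  scomm (t && u (+) t && x) A (scomm (u && x) B C)
  + (-1) ^+ (u && x) *: scomm (t && u (+) x && u) (scomm (t && x) A C) B
  = scomm (t && x (+) u && x) (scomm (t && u) A B) C.
Proof.
rewrite /scomm !(mulmxBl, mulmxBr, scalerBr) -!scalemxAl -!scalemxAr !mulmxA.
(* Only the six triple products occur, so the claim is an identity of signs for each of the eight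
   parity choices. *)
move: (A *m B *m C) (A *m C *m B) (B *m A *m C).
move: (B *m C *m A) (C *m A *m B) (C *m B *m A).
move=> M1 M2 M3 M4 M5 M6; apply/matrixP => i j; rewrite !mxE.
by case: t u x => [] [] [] /=; ring.
Qed.

(** All derivatives kill 1, so only matrix units in the first column can act on it nontrivially. *)
Lemma e_on1 i j r :
  e mu i j r 1 = if (j == first_index) then
     if index_kind i is Some a then z K (a, r) else (mu *+ (r == 0)) *: 1 else 0.
Proof.
rewrite -(inj_eq (@index_kind_inj p n)) index_ofK /e.
case: (index_kind i) (index_kind j) => [a|] [b|] /=.
- exact: (shift_op1 K a b r).
- by rewrite mulr1.
- exact: lower_op1.
- exact: e11_1.
Qed.

(** Either the unit is some $E_{c,1}$, which multiplies by a generator, or it maps 1 to a scalar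
    multiple of 1. *)
Lemma e_on1_cases k l s :
  (exists c, k = letter_index c /\ l = first_index) \/
  ((l = first_index -> k = first_index) /\ exists x, e mu k l s 1 = x *: 1).
Proof.
rewrite e_on1 -{1 2}(index_kindK k).
case: (index_kind k) => [c|]; have [->|/eqP lf] := eqVneq l first_index.
- by left; exists c.
- by right; split=> //; exists 0; rewrite scale0r.
- by right; split=> //; exists (mu *+ (s == 0)).
- by right; split=> //; exists 0; rewrite scale0r.
Qed.

(** After reduction to matrix units, [act_zM] settles the case where one of them is $E_{c,1}$.
    Otherwise both map 1 to scalars, and their bracket kills 1. *)
Lemma act_bracket1 t u A B r s : homog t A -> homog u B ->
  act A r (act B s 1) = (-1) ^+ (t && u) *: act B s (act A r 1)
    + act (scomm (t && u) A B) (r + s) 1.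
Proof.
move=> hA; move: B; apply: homog_ind.
- by rewrite scomm0r !act0l linear0 scaler0 addr0.
- move=> x B B' hB hB'.
  rewrite scomm_linearr !act_linearl linearP /= hB hB' !scalerDr !scalerA.
  by rewrite [x * _]mulrC -!addrA; congr (_ + _); rewrite addrCA.
move=> k l <-; move: A hA; apply: homog_ind.
- by rewrite scomm0l !act0l linear0 scaler0 addr0.
- move=> x A A' hA hA'.
  rewrite scomm_linearl !act_linearl linearP /= hA hA' !scalerDr !scalerA.
  by rewrite [x * _]mulrC -!addrA; congr (_ + _); rewrite addrCA.

move=> i j <-; set t' := _ (+) _; set u' := _ (+) _.
have hA : homog t' (delta_mx i j : gl) by apply: homog_delta.
have hB : homog u' (delta_mx k l : gl) by apply: homog_delta.
have eZ c q w : act (delta_mx (letter_index c) first_index) q w = z K (c, q) * w.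
  by rewrite act_delta /e !index_ofK.
have [[c [kc lf]]|[klf [x ex]]] := e_on1_cases k l s.
  have -> : u' = odd_letter c.
    by rewrite /u' kc lf odd_letter_index odd_first_index addbF.
  by rewrite kc lf !eZ (act_zM mu r c s 1 hA).
(* With the roles exchanged, [act_zM] gives the relation for $[B,A]$; the supercommutator is skew up
   to the sign that is moved across. *)
have [[c [ic jf]]|[ijf [y ey]]] := e_on1_cases i j r.
  have -> : t' = odd_letter c.
    by rewrite /t' ic jf odd_letter_index odd_first_index addbF.
  rewrite ic jf !eZ (act_zM mu s c r 1 hB) scalerDr scalerA [s + r]addrC andbC.
  rewrite -signr_addb addbb scale1r -addrA -actZl -actDl /scomm.
  rewrite scalerBr scalerA -signr_addb addbb scale1r.
  by rewrite addrA addrNK subrr act0l addr0.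
have e0 i' j' q : j' != first_index -> e mu i' j' q 1 = 0.
  by rewrite e_on1 => /negPf ->.
(* Neither unit is $E_{c,1}$: if both columns are the first, both units equal $E_{1,1}$; otherwise
   every surviving product has a column different from the first. *)
have s0 : act (scomm (t' && u') (delta_mx i j) (delta_mx k l)) (r + s) 1 = 0.
  rewrite /scomm actBl actZl !mul_delta_mx_cond.
  have [lf|lf] := eqVneq l first_index; have [jf|jf] := eqVneq j first_index.
  - rewrite /t' /u' jf lf (ijf jf) (klf lf) odd_first_index expr0 scale1r.
    by rewrite subrr.
  - rewrite (klf lf) (negPf jf) mulr0n act0l sub0r.
    by case: (_ == i); rewrite ?act0l ?act_delta ?e0 ?scaler0 ?oppr0.
  - rewrite (ijf jf) (negPf lf) mulr0n act0l scaler0 subr0.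
    by case: (_ == k); rewrite ?act0l ?act_delta ?e0.
  - case: (j == k); case: (l == i);
      by rewrite ?act0l ?act_delta ?e0 ?scaler0 ?subr0.
rewrite s0 addr0 !act_delta ex ey !linearZ /= ex ey.
(* The scalars contribute only if both units are $E_{1,1}$, which is even, so the sign is
   harmless. *)
have yx0 : j != first_index \/ l != first_index -> (y * x) *: (1 : W) = 0.
  case=> [jf|lf]; first by rewrite mulrC -scalerA -ey e0 // scaler0.
  by rewrite -scalerA -ex e0 // scaler0.
rewrite !scalerA [x * y]mulrC [y * _ * x]mulrAC [y * x * _]mulrC -[in RHS]scalerA.
have [lf|lf] := eqVneq l first_index; last by rewrite yx0 ?scaler0 //; right.
have [jf|jf] := eqVneq j first_index; last by rewrite yx0 ?scaler0 //; left.
by rewrite /t' jf (ijf jf) odd_first_index expr0 scale1r.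
Qed.

(* Induction on w along words; the inductive step is the Jacobi identity. *)
Lemma act_bracket t u A B r s w : homog t A -> homog u B ->
  act A r (act B s w) = (-1) ^+ (t && u) *: act B s (act A r w)
    + act (scomm (t && u) A B) (r + s) w.
Proof.
(* The matrices, parities and modes stay general because the hypothesis is also applied to brackets
   with $E_{c,1}$. *)
move=> hA hB; elim/What_ind: w => [|x v w Hv Hw|[c q] w IH] in t u A B r s hA hB *.
- exact: act_bracket1.
- rewrite !linearP /= (Hv t u) // (Hw t u) // !scalerDr !scalerA [x * _]mulrC -!addrA.
  by congr (_ + _); rewrite addrCA.
have hz := homog_delta K (letter_index c) first_index.
rewrite odd_letter_index odd_first_index addbF in hz.
rewrite !(@act_zM _ _ _ mu u B) // !(@act_zM _ _ _ mu t A) // !linearD !linearZ /=.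
rewrite (@act_zM _ _ _ mu u B) // (@act_zM _ _ _ mu t A) //.
rewrite (@act_zM _ _ _ mu (t (+) u)); last exact: homog_scomm.
set x := odd_letter c in hz *; set Z := delta_mx _ _ in hz *.
have jac := scomm_jacobi t u x A B Z.
(* The correction $[[A,B],Z]$ splits into $[A,[B,Z]]$ and $[[A,Z],B]$, each the bracket of an
   instance of the induction hypothesis. *)
rewrite andb_addl -jac actDl actZl.
rewrite (IH _ _ A (scomm (u && x) B Z) _ _ hA (homog_scomm _ hB hz)).
rewrite (IH _ _ A B _ _ hA hB).
rewrite (IH _ _ (scomm (t && x) A Z) B _ _ (homog_scomm _ hA hz) hB).
rewrite [x && u]andbC in jac *; rewrite [r + q + s]addrAC [r + (s + q)]addrA.
rewrite !(andb_addr, andb_addl) [x && u]andbC mulrDr -!scalerAr.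
rewrite !scalerDr !scalerA -!signr_addb !addrA [LHS](ACl (1*5*3*2*6*4)) /=.
by congr (_ *: _ + _ *: _ + _ *: _ + _ *: _ + _ + _ *: _);
  case: (t) (u) (x) => [] [] [].
Qed.

(** * Compatibility with the degree operator and with parity *)

Lemma DE w :
  D w = \sum_a \sum_(r \in [set: int]) r%:~R *: (z K (a, r) * diff (a, r) w).
Proof. by rewrite /D big_sumType. Qed.

Lemma fin_supp_degree a w :
  fin_supp (fun r => r%:~R *: (z K (a, r) * diff (a, r) w)).
Proof. by apply: fin_supp_sub (fin_supp_diff a w) => r ->; rewrite mulr0 scaler0. Qed.

Lemma D_is_linear : linear (@D K p n).
Proof.
move=> x v w; rewrite !DE scaler_sumr -big_split; apply: eq_bigr => a _ /=.
rewrite -fsumZ; last exact: fin_supp_degree.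
rewrite -fsumD; last 2 first.
- by apply: fin_supp_sub (fin_supp_degree a v) => r ->; rewrite scaler0.
- exact: fin_supp_degree.
apply: eq_fsbigr => r _; rewrite linearP mulrDr scalerDr -scalerAr.
by rewrite !scalerA [x * _]mulrC.
Qed.
HB.instance Definition _ :=
  GRing.isLinear.Build K W W *:%R (@D K p n) D_is_linear.

Lemma D1 : D (1 : W) = 0.
Proof.
rewrite DE big1 // => a _; apply: fsbig1 => r _.
by rewrite diff1 mulr0 scaler0.
Qed.

(** [D] is an even derivation: moving a generator past [z K (a, r)] and past its derivative gives
    the same sign twice. Only [a = c], [r = q] leaves a delta term. *)
Lemma D_zM c q w :
  D (z K (c, q) * w) = q%:~R *: (z K (c, q) * w) + z K (c, q) * D w.
Proof.
rewrite !DE.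
have E a : \sum_(r \in [set: int])
      r%:~R *: (z K (a, r) * diff (a, r) (z K (c, q) * w))
   = (a == c)%:R *: (q%:~R *: (z K (c, q) * w))
   + z K (c, q) * \sum_(r \in [set: int]) r%:~R *: (z K (a, r) * diff (a, r) w).
  rewrite -fsumMl; last exact: fin_supp_degree.
  pose F s : W := s%:~R *: (z K (a, s) * w).
  have -> : (a == c)%:R *: (q%:~R *: (z K (c, q) * w))
      = ((a, q) == (c, q))%:R *: F q.
    rewrite xpair_eqE eqxx andbT /F; case: eqP => [->|] //=.
    by rewrite !scale0r.
  rewrite -(fsum_deltaP F (@pair_letter_eq _ _ a c q)) -fsumD; last 2 first.
  - exact: fin_supp_delta (@pair_letter_eq _ _ a c q).
  - by apply: fin_supp_sub (fin_supp_degree a w) => r ->; rewrite mulr0.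
  apply: eq_fsbigr => r _; rewrite diff_zM mulrDr scalerDr -!scalerAr; congr (_ + _).
    by rewrite scalerA mulrC -scalerA.
  by rewrite mulrA zC -scalerAl !scalerA -?mulrA -signr_addb addbb mulr1.
under eq_bigr do rewrite E.
rewrite big_split /= -mulr_sumr; congr (_ + _).
rewrite (bigD1 c) //= eqxx scale1r big1 ?addr0 // => a /negPf ->.
by rewrite scale0r.
Qed.

(** The relation $[d,A\otimes t^r]=rA\otimes t^r$. In the inductive step the commutator with a
    generator has mode [r + q], and [q] is the eigenvalue of that generator. *)
Lemma D_act t A r w : homog t A ->
  D (act A r w) = act A r (D w) + r%:~R *: act A r w.
Proof.
move=> hA; elim/What_ind: w => [|x v w Hv Hw|[c q] w IH] in t A r hA *.
- move: A hA; apply: homog_ind.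
  + by rewrite !act0l linear0 scaler0 addr0.
  + move=> x A B HA HB; rewrite !act_linearl linearP /= HA HB.
    by rewrite !scalerDr !scalerA [x * _]mulrC -addrA [in RHS]addrACA addrA.
  move=> i j _; rewrite !act_delta D1 linear0 add0r e_on1.
  case: ifP => _; last by rewrite linear0 scaler0.
  case: (index_kind i) => [c|].
    by rewrite -[z K _]mulr1 D_zM D1 mulr0 addr0.
  rewrite linearZ /= D1 scaler0; have [->|_] := eqVneq r 0.
    by rewrite scale0r.
  by rewrite mulr0n scale0r scaler0.
- rewrite !linearP /= (Hv t) // (Hw t) // !scalerDr !scalerA [x * _]mulrC.
  by rewrite addrACA.
have hz := homog_delta K (letter_index c) first_index.
rewrite odd_letter_index odd_first_index addbF in hz.
rewrite (act_zM mu r c q w hA) linearD linearZ /= D_zM.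
rewrite (IH _ _ _ hA) (IH _ _ _ (homog_scomm _ hA hz)).
have -> : D (z K (c, q) * w) = q%:~R *: (z K (c, q) * w) + z K (c, q) * D w.
  exact: D_zM.
rewrite [act A r (q%:~R *: _ + _)]linearP /= !(act_zM mu r c q _ hA).
rewrite mulrDr -scalerAr !scalerDr rmorphD scalerDl !scalerA !addrA.
rewrite [LHS](ACl (1*6*2*4*3*5)) /=.
by congr (_ *: _ + _ + _ + _ + _ *: _ + _); rewrite mulrC.
Qed.

(** Conjugation by the parity automorphism detects the parity of an operator; this yields the parity
    axiom. *)
Lemma sigma_act t A r w : homog t A ->
  sigma (act A r w) = (-1) ^+ t *: act A r (sigma w).
Proof.
move=> hA; elim/What_ind: w => [|x v w Hv Hw|[c q] w IH] in t A r hA *.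
- move: A hA; apply: homog_ind.
  + by rewrite !act0l linear0 scaler0.
  + move=> x A B HA HB; rewrite !act_linearl linearP /= HA HB.
    by rewrite !scalerDr !scalerA [x * _]mulrC.
  move=> i j <-; rewrite !act_delta sigma1 e_on1.
  case: eqP => [->|_]; last by rewrite linear0 scaler0.
  rewrite odd_first_index odd_indexE; case: (index_kind i) => [c|].
    by rewrite sigma_z addbF.
  by rewrite linearZ /= sigma1 expr0 scale1r.
- by rewrite !linearP /= (Hv t) // (Hw t) // !scalerDr !scalerA [x * _]mulrC.
have hz := homog_delta K (letter_index c) first_index.
rewrite odd_letter_index odd_first_index addbF in hz.
rewrite (act_zM mu r c q w hA) linearD linearZ /= !sigmaM sigma_z.
rewrite (IH _ _ _ hA) (IH _ _ _ (homog_scomm _ hA hz)).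
rewrite -!scalerAl -scalerAr [in RHS]linearZ /= (act_zM mu r c q _ hA).
rewrite !scalerDr !scalerA signr_addb.
by congr (_ *: _ + _); rewrite mulrC [_ ^+ odd_gen _ * _]mulrC.
Qed.

Lemma sigma_D w : sigma (D w) = D (sigma w).
Proof.
elim/What_ind: w => [|x v w Hv Hw|[c q] w IH].
- by rewrite sigma1 D1 linear0.
- by rewrite !linearP /= Hv Hw.
rewrite sigmaM D_zM linearD linearZ /= !sigmaM IH sigma_z -!scalerAl.
by rewrite [in RHS]linearZ /= D_zM scalerDr !scalerA mulrC.
Qed.

(** * The loop algebra and the module axioms *)

Lemma fin_supp_loop f : fin_supp f.
Proof.
case: f => f /= /asboolP /finite_seqP [s sE]; exists s => r rs; apply/eqP.
have : ~ [set` s]%classic r by apply/negP.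
by rewrite -sE /= => /negP; rewrite negbK.
Qed.

Definition loop_act f w : W := \sum_(r \in [set: int]) act (f r) r w.

Lemma fin_supp_loop_act f w : fin_supp (fun r => act (f r) r w).
Proof. by apply: fin_supp_sub (fin_supp_loop f) => r ->; rewrite act0l. Qed.
Hint Resolve fin_supp_loop_act : core.

Lemma loop_act_linearl w : linear (loop_act ^~ w).
Proof.
move=> x f g; rewrite -fsumZ // -fsumD //; last first.
  by apply: fin_supp_sub (fin_supp_loop_act f w) => r ->; rewrite scaler0.
by apply: eq_fsbigr => r _; rewrite -act_linearl.
Qed.

Lemma loop_act_linearr f : linear (loop_act f).
Proof.
move=> x v w; rewrite -fsumZ // -fsumD //; last first.
  by apply: fin_supp_sub (fin_supp_loop_act f v) => r ->; rewrite scaler0.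
by apply: eq_fsbigr => r _; rewrite linearP.
Qed.
HB.instance Definition _ f :=
  GRing.isLinear.Build K W W *:%R (loop_act f) (loop_act_linearr f).

(** The arguments are exchanged so that linearity in the loop can be registered and sums of tensors
    distributed. *)
Definition loop_actr w f := loop_act f w.
HB.instance Definition _ w :=
  GRing.isLinear.Build K (loop K p n) W *:%R (loop_actr w) (loop_act_linearl w).

Lemma loop_act_tensor A r w : loop_act (tensor A r) w = act A r w.
Proof.
rewrite /loop_act (fsumE (s := [:: r])) //; first by rewrite big_seq1 /= eqxx.
by move=> s; rewrite inE /= => /negPf ->; rewrite act0l.
Qed.

Lemma tensor0 r : tensor (0 : gl) r = 0.
Proof. by apply/val_inj/funext => s /=; rewrite if_same. Qed.

Lemma loop_act_fsum_tensor (F : int -> gl) w : fin_supp F ->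
  loop_act (\sum_(r \in [set: int]) tensor (F r) r) w
  = \sum_(r \in [set: int]) act (F r) r w.
Proof.
move=> sF; rewrite -/(loop_actr w _) raddf_fsum /=.
  by apply: eq_fsbigr => r _; apply: loop_act_tensor.
by apply: fin_supp_sub sF => r ->; rewrite tensor0.
Qed.

Lemma gl_part_homog (t b : bool) A : homog t A -> gl_part b A = if b == t then A else 0.
Proof.
move=> hA; case: eqP => [->|/eqP bt] //; apply/matrixP => i j; rewrite !mxE.
case: eqP => // ij; move/homogP: hA => -> //.
by rewrite ij.
Qed.

(** Of the four pairs of homogeneous parts only the one of parities [t] and [u] survives. *)
Lemma gl_bracket_homog t u A B : homog t A -> homog u B ->
  gl_bracket A B = scomm (t && u) A B.
Proof.
move=> hA hB; rewrite /gl_bracket (bigD1 t) //= (bigD1 u) //= !big1 ?addr0.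
- by rewrite (gl_part_homog _ hA) (gl_part_homog _ hB) !eqxx.
- move=> b bt; rewrite big1 // => c _.
  by rewrite (gl_part_homog _ hA) (negPf bt) mul0mx mulmx0 scaler0 subr0.
move=> b bu; rewrite (gl_part_homog b hB) (negPf bu).
by rewrite mul0mx mulmx0 scaler0 subr0.
Qed.

Lemma gl_bracket0l B : gl_bracket 0 B = 0.
Proof.
have h0 : homog false (0 : gl) by apply/homogP => i j _; rewrite mxE.
rewrite /gl_bracket big1 // => b _; rewrite big1 // => c _.
by rewrite (gl_part_homog b h0) if_same mul0mx mulmx0 scaler0 subr0.
Qed.

Lemma gl_bracket0r B : gl_bracket B 0 = 0.
Proof.
have h0 : homog false (0 : gl) by apply/homogP => i j _; rewrite mxE.
rewrite /gl_bracket big1 // => b _; rewrite big1 // => c _.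
by rewrite (gl_part_homog c h0) if_same mul0mx mulmx0 scaler0 subr0.
Qed.

(** The operator of $[d,f]$. *)
Definition degree_act f w : W := \sum_(r \in [set: int]) r%:~R *: act (f r) r w.

Lemma loop_act_degree f w :
  loop_act (\sum_(r \in [set: int]) tensor (r%:~R *: f r) r) w = degree_act f w.
Proof.
rewrite loop_act_fsum_tensor.
  by apply: eq_fsbigr => r _; rewrite actZl.
by apply: fin_supp_sub (fin_supp_loop f) => r ->; rewrite scaler0.
Qed.

Lemma D_loop_act t f w : (forall r, homog t (f r)) ->
  D (loop_act f w) = loop_act f (D w) + degree_act f w.
Proof.
move=> hf; rewrite raddf_fsum // -fsumD //.
  by apply: eq_fsbigr => r _; rewrite /= (D_act _ _ (hf r)).
by apply: fin_supp_sub (fin_supp_loop_act f w) => r ->; rewrite scaler0.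
Qed.

(** [act_bracket] summed over lists that contain the supports; no central term occurs because the
    centre acts as 0. *)
Lemma loop_act_bracket t u f f' w :
  (forall r, homog t (f r)) -> (forall r, homog u (f' r)) ->
  loop_act f (loop_act f' w) = (-1) ^+ (t && u) *: loop_act f' (loop_act f w)
  + loop_act (\sum_(r \in [set: int]) \sum_(s \in [set: int])
      tensor (gl_bracket (f r) (f' s)) (r + s)) w.
Proof.
move=> hf hg.
have [S uS fS] := fin_supp_uniq (fin_supp_loop f).
have [T uT gT] := fin_supp_uniq (fin_supp_loop f').
have LS v : loop_act f v = \sum_(r <- S) act (f r) r v.
  by rewrite /loop_act (fsumE uS) // => r /fS ->; rewrite act0l.
have LT v : loop_act f' v = \sum_(r <- T) act (f' r) r v.
  by rewrite /loop_act (fsumE uT) // => r /gT ->; rewrite act0l.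
have -> : \sum_(r \in [set: int]) \sum_(s \in [set: int])
      tensor (gl_bracket (f r) (f' s)) (r + s)
    = \sum_(r <- S) \sum_(s <- T) tensor (gl_bracket (f r) (f' s)) (r + s).
  rewrite (fsumE uS); last first.
    by move=> r /fS fr; apply: fsbig1 => s _; rewrite fr gl_bracket0l tensor0.
  apply: eq_bigr => r _; rewrite (fsumE uT) // => s /gT ->.
  by rewrite gl_bracket0r tensor0.
have -> : loop_act (\sum_(r <- S) \sum_(s <- T)
      tensor (gl_bracket (f r) (f' s)) (r + s)) w
    = \sum_(r <- S) \sum_(s <- T) act (scomm (t && u) (f r) (f' s)) (r + s) w.
  rewrite -/(loop_actr w _) raddf_sum; apply: eq_bigr => r _.
  rewrite raddf_sum; apply: eq_bigr => s _.
  by rewrite /= /loop_actr loop_act_tensor (gl_bracket_homog (hf r) (hg s)).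
rewrite LT LS LS LT scaler_sumr.
have -> : \sum_(s <- T)
      (-1) ^+ (t && u) *: act (f' s) s (\sum_(r <- S) act (f r) r w)
   = \sum_(r <- S) \sum_(s <- T) (-1) ^+ (t && u) *: act (f' s) s (act (f r) r w).
  rewrite [RHS]exchange_big /=; apply: eq_bigr => s _.
  by rewrite (raddf_sum (act (f' s) s)) scaler_sumr.
rewrite -big_split; apply: eq_bigr => r _ /=.
rewrite raddf_sum -big_split; apply: eq_bigr => s _ /=.
exact: act_bracket.
Qed.

Lemma ghat_actE u w :
  ghat_act mu u w = loop_act (loop_part u) w + d_part u *: D w.
Proof. by []. Qed.

(** [sigma] is an involution, so its eigenspaces for 1 and -1 split [What], with projections
    $(v\pm\sigma v)/2$. *)
Lemma What_grading : is_grading (@What_homog K p n).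
Proof.
split=> [b|v].
  split=> [|x v w /eqP hv /eqP hw]; apply/eqP; first by rewrite linear0 scaler0.
  by rewrite linearP /= hv hw scalerDr !scalerA mulrC.
exists (2^-1 *: (v + sigma v), 2^-1 *: (v - sigma v)); split=> /=.
  split.
  - by apply/eqP; rewrite linearZ linearD /= sigmaK addrC expr0 scale1r.
  - apply/eqP; rewrite linearZ linearB /= sigmaK expr1 scaleN1r -scalerN.
    by rewrite opprB.
  - rewrite -scalerDr addrACA subrr addr0 -mulr2n -scaler_nat scalerA.
    by rewrite mulVf ?pnatr_eq0 // scale1r.
case=> v0 v1 /= [/eqP h0 /eqP h1 ->].
have -> : sigma (v0 + v1) = v0 - v1.
  by rewrite linearD /= h0 h1 expr0 expr1 scale1r scaleN1r.
rewrite opprD opprK addrACA subrr addr0 [v0 + v1 + _]addrACA subrr add0r.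
by rewrite -!mulr2n -!scaler_nat !scalerA mulVf ?pnatr_eq0 // !scale1r.
Qed.

Lemma What_super_module :
  is_super_module (@ghat_homog K p n) (@ghat_bracket K p n)
    (@What_homog K p n) (@ghat_act K p n mu).
Proof.
split.
- exact: What_grading.
- move=> w x u v; rewrite !ghat_actE.
  have -> : d_part (x *: u + v) = x * d_part u + d_part v by [].
  rewrite loop_act_linearl; move: (D w) => y.
  by rewrite scalerDr scalerDl scalerA addrACA.
- move=> u x v w; rewrite !ghat_actE (linearP (loop_act _)) (linearP (@D K p n)) /=.
  move: (D v) (D w) => Dv Dw.
  by rewrite !scalerDr !scalerA [x * _]mulrC addrACA.
- move=> b c u w /asboolP [hb Kb] /eqP hw; apply/eqP.
  rewrite ghat_actE (linearD (@sigma K p n)) linearZ_LR /=.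
  rewrite sigma_D hw (linearZ_LR (@D K p n)) /=.
  move: (D w) => Dw; rewrite scalerDr.
  rewrite signr_addb; congr (_ + _).
    rewrite (raddf_fsum (@sigma K p n)) // -fsumZ //.
    apply: eq_fsbigr => r _.
    by rewrite /= (sigma_act _ _ (hb r)) hw linearZ /= scalerA.
  case: b Kb {hb} => [/(_ isT) [_ ->]|_]; first by rewrite !scale0r scaler0.
  by rewrite expr0 mul1r !scalerA mulrC.
move=> b c u u' w /asboolP [hf Kf] /asboolP [hg Kg].
have Lb : loop_act (loop_part (ghat_bracket u u')) w =
    loop_act (\sum_(r \in [set: int]) \sum_(s \in [set: int])
      tensor (gl_bracket (loop_part u r) (loop_part u' s)) (r + s)) w
    + d_part u *: degree_act (loop_part u') w
    - d_part u' *: degree_act (loop_part u) w.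
  rewrite -!loop_act_degree -!/(loop_actr w _) -!linearZ_LR -linearD -linearB.
  by [].
(* An odd element has no d-component, so the sign is 1 wherever that component is nonzero. *)
have sd : (-1) ^+ (b && c) * d_part u = d_part u.
  by case: b Kf {hf} => [/(_ isT) [_ ->]|_]; rewrite ?mulr0 ?expr0 ?mul1r.
have sd' : (-1) ^+ (b && c) * d_part u' = d_part u'.
  case: c Kg {hg sd} => [/(_ isT) [_ ->]|_]; rewrite ?mulr0 ?andbF ?expr0 ?mul1r //.
rewrite !ghat_actE Lb.
have -> : d_part (ghat_bracket u u') = 0 by [].
rewrite scale0r addr0.
rewrite !(linearD (loop_act _)) !(linearZ_LR (loop_act _)).
rewrite !(linearD (@D K p n)) !(linearZ_LR (@D K p n)) /=.
rewrite (D_loop_act w hf) (D_loop_act w hg) (loop_act_bracket w hf hg).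
move: (loop_act (loop_part u) (D w)) (loop_act (loop_part u') (D w)) => Y Z.
move: (loop_act (loop_part u') (loop_act (loop_part u) w)) (D (D w)) => X V.
move: (loop_act _ w) (degree_act _ w) (degree_act _ w) => B P Q.
move: (d_part u) (d_part u') sd sd' => d d' sd sd'.
rewrite !scalerDr !scalerA sd sd' [d' * d]mulrC !opprD !addrA.
(* The first group is the action of the bracket; each of the four pairs after it cancels. *)
rewrite [RHS](ACl ((2*5*10)*(1*7)*(4*8)*(3*9)*(6*11))) /=.
by rewrite !subrr !addr0.
Qed.

(** * Filtration by word length, generated inductively so that no monomial basis is required *)

Inductive deg_le : nat -> W -> Prop :=
| deg_le0 d : deg_le d 0
| deg_le1 d : deg_le d 1
| deg_leP d x v w : deg_le d v -> deg_le d w -> deg_le d (x *: v + w)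
| deg_leM d g w : deg_le d w -> deg_le d.+1 (z K g * w).

Lemma deg_leS d d' w : (d <= d')%N -> deg_le d w -> deg_le d' w.
Proof.
move=> dd' H; elim: H d' dd' => {d w} [d|d|d x v w _ Hv _ Hw|d g w _ Hw] d' dd'.
- exact: deg_le0.
- exact: deg_le1.
- by apply: deg_leP; [apply: Hv|apply: Hw].
- by case: d' dd' => // d' dd'; apply: deg_leM; apply: Hw.
Qed.

Lemma deg_leZ d x w : deg_le d w -> deg_le d (x *: w).
Proof. by move=> H; rewrite -[_ *: _]addr0; apply: deg_leP => //; apply: deg_le0. Qed.

Lemma deg_leD d v w : deg_le d v -> deg_le d w -> deg_le d (v + w).
Proof. by move=> Hv Hw; rewrite -[v]scale1r; apply: deg_leP. Qed.

Lemma deg_le_sum (J : Type) d (t : seq J) (F : J -> W) :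
  (forall x, deg_le d (F x)) -> deg_le d (\sum_(x <- t) F x).
Proof.
move=> dF; apply: big_ind => //; first exact: deg_le0.
by move=> v w; apply: deg_leD.
Qed.

Lemma deg_le_exists w : exists d, deg_le d w.
Proof.
elim/What_ind: w => [|x v w [d dv] [d' dw]|g w [d dw]].
- by exists 0%N; apply: deg_le1.
- exists (maxn d d'); apply: deg_leP.
    by apply: deg_leS dv; apply: leq_maxl.
  by apply: deg_leS dw; apply: leq_maxr.
- by exists d.+1; apply: deg_leM.
Qed.

Lemma deg_le0E d w : deg_le d w -> d = 0%N -> exists x, w = x *: 1.
Proof.
elim=> {d w} [d|d|d x v w _ Hv _ Hw|d g w _ _] // d0.
- by exists 0; rewrite scale0r.
- by exists 1; rewrite scale1r.
- have [y ->] := Hv d0; have [y' ->] := Hw d0.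
  by exists (x * y + y'); rewrite scalerDl scalerA.
Qed.

Lemma deg_le_diff d g w : deg_le d w -> deg_le d.-1 (diff g w).
Proof.
elim=> {d w} [d|d|d x v w _ Hv _ Hw|d h w Hw IH].
- by rewrite linear0; apply: deg_le0.
- by rewrite diff1; apply: deg_le0.
- by rewrite linearP; apply: deg_leP.
rewrite diff_zM; apply: deg_leP => //; apply: deg_leZ.
(* The predecessor is cut off at 0: for words of length at most one, [w] is a scalar and the second
   Leibniz term vanishes. *)
case: d Hw IH => [|d] Hw IH /=; last exact: deg_leM.
have [x ->] := deg_le0E Hw erefl.
by rewrite linearZ /= diff1 scaler0 mulr0; apply: deg_le0.
Qed.

Lemma deg_le_shift d a b r w : deg_le d w -> deg_le d (shift_op a b r w).
Proof.
case: d => [|d] dw.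
  have [x ->] := deg_le0E dw erefl.
  by rewrite linearZ /= shift_op1 scaler0; apply: deg_le0.
rewrite /shift_op; have [s us sF] := fin_supp_uniq (fin_supp_shift a b r w).
rewrite (fsumE us sF); apply: deg_le_sum => q.
exact: deg_leM (deg_le_diff _ dw).
Qed.

Lemma deg_le_e11 d r w : deg_le d w -> deg_le d (e11 mu r w).
Proof.
move=> dw; rewrite e11E; apply: deg_leP => //; rewrite -scaleN1r.
by apply: deg_leZ; apply: deg_le_sum => a; apply: deg_le_shift.
Qed.

Lemma deg_le_lower d b r w : deg_le d w -> deg_le d.-1 (lower_op mu b r w).
Proof.
move=> dw; rewrite /lower_op; have [s us sF] := fin_supp_uniq (fin_supp_lower mu b r w).
rewrite (fsumE us sF); apply: deg_le_sum => q.
exact/deg_le_e11/deg_le_diff.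
Qed.

(** The sum of the operators $z_g\partial_g$ over all generators, equal to [mu] minus [e11] at mode
    0. *)
Definition euler w : W := \sum_a shift_op a a 0 w.

Lemma euler_is_linear : linear euler.
Proof.
move=> x v w; rewrite /euler scaler_sumr -big_split; apply: eq_bigr => a _.
by rewrite linearP.
Qed.
HB.instance Definition _ := GRing.isLinear.Build K W W *:%R euler euler_is_linear.

Lemma eulerM g w : euler (z K g * w) = z K g * w + z K g * euler w.
Proof.
case: g => c q; rewrite /euler.
under eq_bigr do rewrite shift_op_zM addbb expr0 scale1r add0r.
rewrite big_split /= -mulr_sumr; congr (_ + _).
rewrite (bigD1 c) //= eqxx scale1r big1 ?addr0 // => a /negPf ->.
by rewrite scale0r.
Qed.

Lemma euler1 : euler 1 = 0.
Proof. by rewrite /euler big1 // => a _; rewrite shift_op1. Qed.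

(* The Euler operator multiplies a word of length d by d. *)
Lemma deg_le_euler d w : deg_le d.+1 w -> deg_le d (euler w - d.+1%:R *: w).
Proof.
move: {-2}d.+1 (erefl d.+1) => d' dd' H.
elim: H d dd' => {d' w} [d'|d'|d' x v w _ Hv _ Hw|d' g w Hw IH] d dd'.
- by rewrite linear0 scaler0 subr0; apply: deg_le0.
- by rewrite euler1 sub0r -scaleNr; apply/deg_leZ/deg_le1.
- rewrite (linearP euler).
  have -> : x *: euler v + euler w - d'%:R *: (x *: v + w)
     = x *: (euler v - d'%:R *: v) + (euler w - d'%:R *: w).
    by rewrite !scalerDr scalerN !scalerA [x * _]mulrC opprD addrACA.
  by apply: deg_leP; [apply: Hv|apply: Hw].
have -> : euler (z K g * w) - d'.+1%:R *: (z K g * w)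
    = z K g * (euler w - d'%:R *: w).
  rewrite eulerM [z K g * w + _]addrC -natr1 scalerDl scale1r mulrBr -scalerAr.
  by rewrite opprD addrACA subrr addr0.
case: dd' => <- {d}.
case: d' Hw IH => [|d'] Hw IH; last by apply/deg_leM/IH.
have [x ->] := deg_le0E Hw erefl.
rewrite (linearZ_LR euler) /= euler1 scaler0 scale0r subr0 mulr0.
exact: deg_le0.
Qed.

(** The Euler operator kills such a [w], so [deg_le_euler] puts $-(d+1)w$ in degree at most [d];
    division by [d.+1] lets the degree descend to 0. *)
Lemma diff_eq0_const w : (forall g, diff g w = 0) -> exists x, w = x *: 1.
Proof.
move=> w0; have [d] := deg_le_exists w.
elim: d => [|d IH] dw; first exact: deg_le0E dw erefl.
apply: IH; have := deg_le_euler dw.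
have -> : euler w = 0.
  rewrite /euler big1 // => a _; apply: fsbig1 => s _.
  by rewrite w0 mulr0.
rewrite sub0r -scaleNr => /(deg_leZ (- d.+1%:R)^-1).
by rewrite scalerA mulVf ?oppr_eq0 ?pnatr_eq0 // scale1r.
Qed.

(** * Elements killed by all lowering operators *)

Lemma diff_bound w :
  exists M : nat, forall a s, (M < `|s|)%N -> diff (a, s) w = 0.
Proof.
elim/What_ind: w => [|x v w [M vM] [N wN]|[c q] w [M wM]].
- by exists 0%N => a s _; rewrite diff1.
- exists (maxn M N) => a s; rewrite gtn_max => /andP[Ms Ns].
  by rewrite linearP /= vM // wN // scaler0 addr0.
exists (maxn M `|q|%N) => a s; rewrite gtn_max => /andP[Ms qs].
rewrite diff_zM wM // mulr0 scaler0 addr0 xpair_eqE.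
have /negPf -> : s != q by apply: contraTneq qs => ->; rewrite ltnn.
by rewrite andbF scale0r.
Qed.

(** In [lower_op] the scalar part of [e11] is nonzero only at [s = - r]; this isolates the single
    term that contains [mu]. *)
Lemma lower_opE b r w : lower_op mu b r w = mu *: diff (b, - r) w
  - \sum_(s \in [set: int]) \sum_a shift_op a a (r + s) (diff (b, s) w).
Proof.
have fs := fin_supp_diff b w.
have -> : mu *: diff (b, - r) w
    = \sum_(s \in [set: int]) (r + s == 0)%:R *: (mu *: diff (b, s) w).
  rewrite (@fsum_deltaP _ _ _ _ _ (- r)) ?subrr ?eqxx ?scale1r // => s.
  by rewrite addrC addr_eq0 => /eqP.
rewrite -fsumN -?fsumD.
- by apply: eq_fsbigr => s _; rewrite e11E scalerA mulr_natl.
- by apply: fin_supp_sub fs => s ->; rewrite !scaler0.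
- by apply: fin_supp_sub fs => s ->; rewrite big1 ?oppr0 // => a _; rewrite linear0.
- by apply: fin_supp_sub fs => s ->; rewrite big1 // => a _; rewrite linear0.
Qed.

Lemma lower_op_eq0 w : mu != 0 ->
  (forall b r, lower_op mu b r w = 0) -> forall g, diff g w = 0.
Proof.
move=> mu0 w0 [b r0]; have [M wM] := diff_bound w.
(* The modes from [-M] to [M], outside which all derivatives of [w] vanish. *)
pose S := [seq m%:Z - M%:Z | m <- iota 0 M.*2.+1].
have uS : uniq S by rewrite map_inj_uniq ?iota_uniq // => m m' /addIr [].
have SE s : (s \in S) = (`|s| <= M)%N.
  apply/mapP/idP => [[m + ->]|sM]; first by rewrite mem_iota; lia.
  by exists (absz (s + M%:Z)); rewrite ?mem_iota; lia.
have SN s : s \notin S -> forall a, diff (a, s) w = 0.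
  by rewrite SE -ltnNge => sM a; apply: wM.
pose dd s a s' := diff (a, s') (diff (b, s) w).
have E r : \sum_(s \in [set: int]) \sum_a shift_op a a (r + s) (diff (b, s) w)
    = \sum_(s <- S) \sum_a \sum_(s' <- S) z K (a, r + s + s') * dd s a s'.
  rewrite (fsumE uS); last first.
    by move=> s /SN ->; rewrite big1 // => a _; rewrite linear0.
  apply: eq_bigr => s _; apply: eq_bigr => a _; rewrite /shift_op (fsumE uS) //.
  by move=> s' /SN s'0; rewrite diffC s'0 linear0 scaler0 mulr0.
(* The coefficient of [z K (a, R + t)] in the part without [mu]; it does not depend on the mode
   [R]. *)
have c0 a (t : int) : \sum_(s <- S) \sum_(s' <- S) (t == s + s')%:R *: dd s a s' = 0.
  (* A sum [s + s'] is at least [-2M], so with [R = 3M + 1] the mode [R + t] exceeds [M] for every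
     relevant [t]. Also [R > M], which removes the term with [mu]. *)
  pose R := (M.*2 + M).+1%:Z.
  have [tM|tM] := leqP (absz (R + t)) M.
    rewrite big_seq big1 // => s; rewrite SE => sM.
    rewrite big_seq big1 // => s'; rewrite SE => s'M.
    suff /negPf -> : t != s + s' by rewrite scale0r.
    by apply/eqP; lia.
  have dd0 s a' s' : diff (a, R + t) (dd s a' s') = 0.
    by rewrite /dd diffC [diff _ (diff _ w)]diffC wM // !(linear0, scaler0).
  have := w0 b R; rewrite lower_opE wM ?scaler0; last by lia.
  rewrite E sub0r => /eqP; rewrite oppr_eq0 => /eqP /(congr1 (diff (a, R + t))).
  (* The derivative at [(a, R + t)] kills the coefficients by [dd0], so only the delta terms with
     letter [a] and [s + s' = t] remain. *)
  rewrite linear0 => dQ0; rewrite -[RHS]dQ0 (raddf_sum (diff (a, R + t))).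
  apply: eq_bigr => s _.
  rewrite (raddf_sum (diff (a, R + t))) (bigD1 a) //=.
  rewrite [X in _ = _ + X]big1 ?addr0; last first.
    move=> a' a'a; rewrite (raddf_sum (diff (a, R + t))) big1 // => s' _.
    rewrite /= diff_zM xpair_eqE eq_sym (negPf a'a) scale0r add0r.
    by rewrite dd0 mulr0 scaler0.
  rewrite (raddf_sum (diff (a, R + t))); apply: eq_bigr => s' _.
  rewrite /= diff_zM xpair_eqE eqxx -addrA (inj_eq (addrI _)).
  by rewrite dd0 mulr0 scaler0 addr0.
(* At mode [- r0] the term with [mu] is the desired derivative; the rest vanishes once it is grouped
   by [t = s + s']. *)
have := w0 b (- r0); rewrite lower_opE opprK E.
rewrite [X in _ - X](_ : _ = 0) ?subr0.
  by move=> /eqP; rewrite scaler_eq0 (negPf mu0) => /eqP.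
rewrite exchange_big big1 // => a _.
(* Each product becomes a sum over [t] with one possible nonzero term, so the sum over [t] can be
   moved outside and [c0] applied. *)
have F s s' : z K (a, - r0 + s + s') * dd s a s' =
   \sum_(t \in [set: int]) (t == s + s')%:R *: (z K (a, - r0 + t) * dd s a s').
  by rewrite (@fsum_deltaP _ _ _ _ _ (s + s')) ?eqxx ?scale1r ?addrA // => t /eqP.
have fsF s s' :
    fin_supp (fun t => (t == s + s')%:R *: (z K (a, - r0 + t) * dd s a s')).
  by apply: (@fin_supp_delta _ _ _ _ _ (s + s')) => t /eqP.
under eq_bigr => s _.
  under eq_bigr do rewrite F.
  rewrite -fsum_sum //.
  over.
rewrite -fsum_sum.
  apply: fsbig1 => t _.
  rewrite -[RHS](mulr0 (z K (a, - r0 + t))) -[in RHS](c0 a t) mulr_sumr.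
  apply: eq_bigr => s _; rewrite mulr_sumr; apply: eq_bigr => s' _.
  by rewrite scalerAr.
by move=> s; apply: fin_supp_sum.
Qed.

(** * Irreducibility and infinite dimension *)

Lemma What_irreducible (U : {pred W}) : mu != 0 -> submod_closed U ->
  (forall u v, v \in U -> ghat_act mu u v \in U) ->
  (forall v, v \in U -> v = 0) \/ (forall v, v \in U).
Proof.
move=> mu0 [U0 UP] UA.
have UZ x v : v \in U -> x *: v \in U.
  by move=> vU; rewrite -[_ *: _]addr0; apply: UP.
have Ue i j r v : v \in U -> e mu i j r v \in U.
  move=> /(UA (tensor (delta_mx i j) r, 0, 0)).
  by rewrite ghat_actE scale0r addr0 loop_act_tensor act_delta.
have Uz g v : v \in U -> z K g * v \in U.
  case: g => a r /(Ue (letter_index a) first_index r).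
  by rewrite /e !index_ofK.
have Ul b r v : v \in U -> lower_op mu b r v \in U.
  by move=> /(Ue first_index (letter_index b) r); rewrite /e !index_ofK.
have U1 w : w \in U -> w != 0 -> (1 : W) \in U.
  have Uc v x : v \in U -> v != 0 -> v = x *: 1 -> (1 : W) \in U.
    move=> vU v0 vE; have x0 : x != 0.
      by apply: contraNneq v0 => x0; rewrite vE x0 scale0r.
    by rewrite -[1]scale1r -(mulVf x0) -scalerA -vE; apply: UZ.
  have [d] := deg_le_exists w; elim: d w => [|d IH] w dw wU wn0.
    by have [x wE] := deg_le0E dw erefl; apply: Uc wE.
  (* Either some lowering operator gives a nonzero element of smaller degree in [U], or [w] is
     itself a nonzero scalar. *)
  have [[b [r br]]|H] := pselect (exists b r, lower_op mu b r w <> 0).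
    apply: (IH (lower_op mu b r w)); last exact/eqP.
      exact: deg_le_lower dw.
    exact: Ul.
  have [|x wE] := @diff_eq0_const w; last exact: Uc wE.
  apply: lower_op_eq0 => // b r; apply: contrapT => br.
  by apply: H; exists b, r.
have [[w [wU wn0]]|H] := pselect (exists w, w \in U /\ w <> 0).
  right; elim/What_ind => [|x v v' vU v'U|g v vU].
  - by apply: U1 wU _; apply/eqP.
  - exact: UP.
  - exact: Uz.
left=> v vU; apply: contrapT => vn0; apply: H.
by exists v.
Qed.

(** The bound on [p.+1 + n] provides a letter; with none, [What] consists of scalars. A finite
    family involves finitely many modes, so a generator of larger mode lies outside its span: its
    derivative kills the family but not itself. *)
Lemma What_infinite_dimensional : (1 < p.+1 + n)%N ->
  infinite_dimensional (What K p n).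
Proof.
move=> pn.
have [a _] : exists a : 'I_p + 'I_n, True.
  move: pn; case: p => [|p']; last by exists (inl ord0).
  by case: n => // n' _; exists (inr ord0).
move=> s.
have [M sM] : exists M : nat, forall i : 'I_(size s), forall r, (M < `|r|)%N ->
    diff (a, r) s`_i = 0.
  elim: s => [|v s [M sM]]; first by exists 0%N; case.
  have [N vN] := diff_bound v.
  exists (maxn M N) => -[[|i] //= si] r; rewrite gtn_max => /andP[Mr Nr].
    exact: vN.
  exact: (sM (Ordinal (si : (i < size s)%N))).
exists (z K (a, M.+1%:Z)) => c /(congr1 (diff (a, M.+1%:Z))) /eqP.
rewrite diff_z eqxx raddf_sum big1 ?oner_eq0 // => i _.
by rewrite /= linearZ_LR /= sM ?scaler0.
Qed.

End Module.

Local Open Scope complex_scope.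

Theorem theorem3p3 (R : realType) (p n : nat) (mu : R[i]) :
  mu != 0 ->
  irreducible_super_module
    (@ghat_homog R[i] p n) (@ghat_bracket R[i] p n)
    (@What_homog R[i] p n) (@ghat_act R[i] p n mu) /\
  ((1 < p.+1 + n)%N -> infinite_dimensional (What R[i] p n)).
Proof.
move=> mu0; split; last exact: What_infinite_dimensional.
split; first exact: What_super_module.
  by exists 1; apply: oner_neq0.
by move=> U; apply: What_irreducible.
Qed.
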